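(* Let $G$ be an Artin–Tits group of finite type with at least three generators, with generating set $S$ and matrix $(m_{st})_{s,t\in S}$, and suppose that there exist $s,t\in S$ with $2<m_{st}<\infty$. Then the groupoid $G\ltimes\widetilde\Omega_\infty$ is not amenable.
   Context: $S$ is a finite set, $(m_{st})_{s,t\in S}$ a symmetric matrix of positive integers with $m_{ss}=1$ and $m_{st}>1$ for $s\neq t$; $(s,t)_m=stst\cdots$ ($m$ factors). $G=\langle S\mid (s,t)_{m_{st}}=(t,s)_{m_{st}},\ s,t\in S\rangle$ is the Artin–Tits group and $P=\langle S\mid (s,t)_{m_{st}}=(t,s)_{m_{st}},\ s,t\in S\rangle^+$ the Artin–Tits monoid; finite type means that the group $W$ with the same presentation as $G$ and the additional relations $s^2=1$ ($s\in S$) is finite. Then $P\subseteq G$, $P$ is right LCM (any $pP\cap qP$ is of the form $rP$) and left reversible. $\mathcal J=\{pP: p\in P\}\cup\{\emptyset\}$; $\Omega$ is the set of surjective maps $\chi:\mathcal J\to\{0,1\}$ with $\chi(\emptyset)=0$ and $\chi(A\cap B)=\chi(A)\chi(B)$, with the topology of pointwise convergence. $P$ is identified with a subset of $\Omega$ via $p\mapsto\chi_{pP}$, $\chi_{pP}(xP)=1$ iff $pP\subseteq xP$; $\infty\in\Omega$ is the map with $\infty(xP)=1$ for all $x\in P$. $\widetilde\Omega_\infty:=\Omega\setminus(P\cup\{\infty\})$. The partial action $G\curvearrowright\Omega$ is given as follows: $U_{g^{-1}}$ is the set of $\chi\in\Omega$ with $\chi(qP)=1$ for some $q\in P$ such that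 $g=pq^{-1}$ for some $p\in P$; for such $\chi$, $(g.\chi)(xP)=\chi(qyP)$ where $xP\cap pP=pyP$. $\widetilde\Omega_\infty$ is $G$-invariant and $G\ltimes\widetilde\Omega_\infty=\{(g,\chi):\chi\in U_{g^{-1}}\cap\widetilde\Omega_\infty\}$ is the partial transformation groupoid. *)

(* Defs.v *)
From HB Require Import structures.
From mathcomp Require Import all_boot all_order all_algebra generic_quotient.
From mathcomp Require Import all_classical all_reals all_analysis.

Set Implicit Arguments.
Unset Strict Implicit.
Unset Printing Implicit Defensive.

Import numFieldNormedType.Exports.

Local Open Scope classical_set_scope.
Local Open Scope group_scope.

Section MonoidPresentation.
Variables (X : choiceType) (R : seq X -> seq X -> Prop).

Inductive word_cong : seq X -> seq X -> Prop :=
| word_cong_rel l u v r : R u v -> word_cong (l ++ u ++ r) (l ++ v ++ r)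
| word_cong_refl u : word_cong u u
| word_cong_sym u v : word_cong u v -> word_cong v u
| word_cong_trans u v w : word_cong u v -> word_cong v w -> word_cong u w.

Lemma word_cong_cat u u' v v' :
  word_cong u u' -> word_cong v v' -> word_cong (u ++ v) (u' ++ v').
Proof.
move=> uu' vv'; apply: (@word_cong_trans _ (u' ++ v)).
- elim: uu' {vv'} => {u u'}.
  + by move=> l u u' r ruu'; rewrite -!catA; exact: word_cong_rel.
  + by move=> u; exact: word_cong_refl.
  + by move=> u u' _; exact: word_cong_sym.
  + by move=> u u' u'' _ h1 _; exact: word_cong_trans.
- elim: vv' => {v v'}.
  + by move=> l v v' r rvv'; rewrite !(catA u'); exact: word_cong_rel.
  + by move=> v; exact: word_cong_refl.
  + by move=> v v' _; exact: word_cong_sym.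
  + by move=> v v' v'' _ h1 _; exact: word_cong_trans.
Qed.

Definition word_congb (u v : seq X) : bool := `[< word_cong u v >].

Lemma word_congb_equiv : equiv_class_of word_congb.
Proof.
split.
- by move=> u; apply/asboolP; exact: word_cong_refl.
- by move=> u v; apply/asboolP/asboolP; exact: word_cong_sym.
- move=> v u w /asboolP uv /asboolP vw; apply/asboolP.
  exact: word_cong_trans uv vw.
Qed.

Canonical word_congb_rel := EquivRelPack word_congb_equiv.

(* The monoid < X | u = v, (u, v) in R >^+ *)
Definition pres_monoid : Type := {eq_quot word_congb}%qT.

HB.instance Definition _ := Choice.on pres_monoid.
HB.instance Definition _ := EqQuotient.on pres_monoid.

Definition pres_class (u : seq X) : pres_monoid := (\pi_{eq_quot word_congb} u)%qT.

Lemma pres_classP u v : pres_class u = pres_class v <-> word_cong u v.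
Proof.
split=> [/eqP|uv]; first by rewrite /pres_class eqquotE => /asboolP.
by apply/eqP; rewrite /pres_class eqquotE; apply/asboolP.
Qed.

Lemma pres_reprK (x : pres_monoid) : pres_class (repr x) = x.
Proof. exact: reprK. Qed.

Lemma repr_pres_class u : word_cong (repr (pres_class u)) u.
Proof. by apply/pres_classP; exact: pres_reprK. Qed.

Definition pres_mul (x y : pres_monoid) : pres_monoid :=
  pres_class (repr x ++ repr y).

Lemma pres_mulE u v : pres_mul (pres_class u) (pres_class v) = pres_class (u ++ v).
Proof. by apply/pres_classP/word_cong_cat; exact: repr_pres_class. Qed.

Lemma pres_mulA : associative pres_mul.
Proof.
move=> x y z.
by rewrite -(pres_reprK x) -(pres_reprK y) -(pres_reprK z) !pres_mulE catA.
Qed.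

Lemma pres_mul1 : left_id (pres_class [::]) pres_mul.
Proof. by move=> x; rewrite -(pres_reprK x) pres_mulE. Qed.

Lemma pres_mulr1 : right_id (pres_class [::]) pres_mul.
Proof. by move=> x; rewrite -(pres_reprK x) pres_mulE cats0. Qed.

HB.instance Definition _ :=
  isMonoid.Build pres_monoid pres_mulA pres_mul1 pres_mulr1.

End MonoidPresentation.

Section GroupPresentation.
Variables (X : choiceType) (R : seq X -> seq X -> Prop).

(* Group words use the letters (x, true) for x and (x, false) for x^-1. *)
Definition pos_word (u : seq X) : seq (X * bool) := [seq (x, true) | x <- u].

Definition inv_letter (a : X * bool) : X * bool := (a.1, ~~ a.2).

Definition inv_word (u : seq (X * bool)) : seq (X * bool) :=
  rev [seq inv_letter a | a <- u].

Inductive group_rel : seq (X * bool) -> seq (X * bool) -> Prop :=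
| group_rel_pos u v : R u v -> group_rel (pos_word u) (pos_word v)
| group_rel_cancel a : group_rel [:: a; inv_letter a] [::].

(* The group < X | u = v, (u, v) in R > *)
Definition pres_group : Type := pres_monoid group_rel.

HB.instance Definition _ := Monoid.on pres_group.

Lemma inv_letterK : involutive inv_letter.
Proof. by case=> x b; rewrite /inv_letter negbK. Qed.

Lemma inv_wordK : involutive inv_word.
Proof.
move=> u; rewrite /inv_word map_rev revK -map_comp -[RHS]map_id.
by apply: eq_map => a /=; rewrite inv_letterK.
Qed.

Lemma word_cong_invr u : word_cong group_rel (u ++ inv_word u) [::].
Proof.
elim/last_ind: u => [|u a ih]; first exact: word_cong_refl.
rewrite /inv_word map_rcons rev_rcons -cats1 -catA /=.
apply: word_cong_trans ih.
by have := word_cong_rel u (inv_word u) (group_rel_cancel a).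
Qed.

Lemma word_cong_invl u : word_cong group_rel (inv_word u ++ u) [::].
Proof. by have := word_cong_invr (inv_word u); rewrite inv_wordK. Qed.

Definition pres_inv (x : pres_group) : pres_group :=
  pres_class group_rel (inv_word (repr x)).

Lemma pres_mulV : forall x : pres_group, pres_inv x * x = 1.
Proof.
move=> x; rewrite -[in X in _ * X](pres_reprK x).
by apply: (etrans (pres_mulE _ _ _)); apply/pres_classP; exact: word_cong_invl.
Qed.

Lemma pres_mulrV : forall x : pres_group, x * pres_inv x = 1.
Proof.
move=> x; rewrite -[in X in X * _](pres_reprK x).
by apply: (etrans (pres_mulE _ _ _)); apply/pres_classP; exact: word_cong_invr.
Qed.

HB.instance Definition _ := hasInv.Build pres_group pres_inv.
HB.instance Definition _ := Monoid_isGroup.Build pres_group pres_mulV pres_mulrV.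

Definition monoid_to_group (p : pres_monoid R) : pres_group :=
  pres_class group_rel (pos_word (repr p)).

Lemma word_cong_pos u v :
  word_cong R u v -> word_cong group_rel (pos_word u) (pos_word v).
Proof.
elim=> {u v}.
- move=> l u v r ruv; rewrite /pos_word !map_cat.
  exact: (word_cong_rel (pos_word l) (pos_word r) (group_rel_pos ruv)).
- by move=> u; exact: word_cong_refl.
- by move=> u v _; exact: word_cong_sym.
- by move=> u v w _ h _; exact: word_cong_trans.
Qed.

Lemma monoid_to_groupE u :
  monoid_to_group (pres_class R u) = pres_class group_rel (pos_word u).
Proof. by apply/pres_classP/word_cong_pos; exact: repr_pres_class. Qed.

Lemma monoid_to_groupM : {morph monoid_to_group : p q / p * q}.
Proof.
move=> p q; rewrite -(pres_reprK p) -(pres_reprK q).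
rewrite (_ : _ * _ = pres_class R (repr p ++ repr q)); last exact: pres_mulE.
rewrite !monoid_to_groupE /pos_word map_cat.
by rewrite -(pres_mulE group_rel).
Qed.

End GroupPresentation.

Definition coxeter_matrix (S : finType) (m : S -> S -> nat) : Prop :=
  [/\ forall s, m s s = 1%N,
      forall s t, m s t = m t s &
      forall s t, s != t -> (1 < m s t)%N].

(* (s, t)_n = s t s t ... with n letters *)
Definition alt_word (S : Type) (s t : S) (n : nat) : seq S :=
  mkseq (fun i => if odd i then t else s) n.

Inductive artin_rel (S : finType) (m : S -> S -> nat) : seq S -> seq S -> Prop :=
| artin_rel_braid s t :
    artin_rel m (alt_word s t (m s t)) (alt_word t s (m s t)).

Inductive coxeter_rel (S : finType) (m : S -> S -> nat) : seq S -> seq S -> Prop :=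
| coxeter_rel_braid u v : artin_rel m u v -> coxeter_rel m u v
| coxeter_rel_square s : coxeter_rel m [:: s; s] [::].

Notation artin_monoid m := (pres_monoid (artin_rel m)).
Notation artin_group m := (pres_group (artin_rel m)).
Notation coxeter_group m := (pres_group (coxeter_rel m)).

Definition finite_type (S : finType) (m : S -> S -> nat) : Prop :=
  finite_set [set: coxeter_group m].

Section Characters.
Variables (X : choiceType) (R : seq X -> seq X -> Prop).

Local Notation P := (pres_monoid R).
Local Notation G := (pres_group R).
Local Notation iota := (@monoid_to_group X R).

Definition pideal (p : P) : set P := [set p * x | x in [set: P]].

Definition constr_ideal : Type :=
  {A : set P | A = set0 \/ exists p, A = pideal p}.

Definition ideal_set (A : constr_ideal) : set P := sval A.
Coercion ideal_set : constr_ideal >-> set.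

Definition ideal0 : constr_ideal := exist _ set0 (or_introl erefl).

Definition ideal_of (p : P) : constr_ideal :=
  exist _ (pideal p) (or_intror (ex_intro _ p erefl)).

Local Notation charT := {ptws constr_ideal -> bool}.

(* When the constructible ideals are closed under intersection (P right LCM),
   C in the last clause ranges exactly over the intersections A `&` B. *)
Definition Omega : set charT :=
  [set chi | [/\ forall b : bool, exists A, chi A = b,
                 chi ideal0 = false &
                 forall A B C : constr_ideal,
                   ideal_set C = ideal_set A `&` ideal_set B ->
                   chi C = chi A && chi B]].

Definition char_of (p : P) : charT := fun A => `[< pideal p `<=` ideal_set A >].

Definition char_infty : charT := fun A => `[< ideal_set A !=set0 >].

Definition Omega_tilde : set charT :=
  Omega `\` (range char_of `|` [set char_infty]).

(* paction_dom g is the set U_{g^-1} on which g acts. *)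
Definition paction_dom (g : G) : set charT :=
  [set chi | Omega chi /\
    exists p q : P, g = iota p * (iota q)^-1 /\ chi (ideal_of q)].

(* (g.chi)(xP) = chi(q y P) where g = p q^-1, chi(q P) = 1, x P `&` p P = p y P.
   When P is right LCM and embeds in G, chi(q y P) does not depend on the choice
   of p, q and y, and the existential says that the common value is 1.  The
   value at the empty ideal is 0. *)
Definition paction (g : G) (chi : charT) : charT := fun A =>
  `[< exists p q y : P,
        [/\ g = iota p * (iota q)^-1,
            chi (ideal_of q),
            ideal_set A `&` pideal p = pideal (p * y) &
            chi (ideal_of (q * y))] >].

End Characters.

(* The arrow and unit spaces are subspaces of ambient topological spaces, on
   which the structure maps are total; only their values on arrows (on
   composable pairs of arrows for the product) are meaningful.  The product
   gamma eta is defined when src gamma = rng eta. *)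
Record top_groupoid := TopGroupoid {
  gpd_ambient : topologicalType ;
  gpd_unit_ambient : topologicalType ;
  gpd_arrow : set gpd_ambient ;
  gpd_unit : set gpd_unit_ambient ;
  gpd_src : gpd_ambient -> gpd_unit_ambient ;
  gpd_rng : gpd_ambient -> gpd_unit_ambient ;
  gpd_mul : gpd_ambient -> gpd_ambient -> gpd_ambient ;
  gpd_inv : gpd_ambient -> gpd_ambient
}.

Arguments gpd_arrow : clear implicits.
Arguments gpd_unit : clear implicits.

Section Amenability.
Local Open Scope ring_scope.
Variables (R : realType) (Gd : top_groupoid).

Local Notation A := (gpd_ambient Gd).
Local Notation X := (gpd_unit_ambient Gd).

Definition gpd_fiber (x : X) : set A :=
  [set gamma | gpd_arrow Gd gamma /\ gpd_rng gamma = x].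

Definition gpd_Cc (f : A -> R) : Prop :=
  {within gpd_arrow Gd, continuous f} /\
  exists K : set A, [/\ compact K, K `<=` gpd_arrow Gd &
    forall gamma, gpd_arrow Gd gamma -> ~ K gamma -> f gamma = 0].

(* A system of probability measures for the range map of an etale groupoid:
   the fibers are discrete, so that a probability measure on a fiber is a
   nonnegative function with sum 1. *)
Definition prob_system (m : X -> A -> R) : Prop :=
  forall x, gpd_unit Gd x ->
    (forall gamma, gpd_fiber x gamma -> 0 <= m x gamma) /\
    \esum_(gamma in gpd_fiber x) (m x gamma)%:E = 1%E.

(* The sums are finite: a compact set of arrows of an etale groupoid meets
   each fiber in a finite set. *)
Definition cont_system (m : X -> A -> R) : Prop :=
  forall f : A -> R, gpd_Cc f ->
    {within gpd_unit Gd,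
      continuous (fun x => \sum_(gamma \in gpd_fiber x) f gamma * m x gamma)}.

(* || gamma . m^{s(gamma)} - m^{r(gamma)} ||_1 *)
Definition translation_defect (m : X -> A -> R) (gamma : A) : \bar R :=
  \esum_(eta in gpd_fiber (gpd_rng gamma))
    (`| m (gpd_src gamma) (gpd_mul (gpd_inv gamma) eta)
        - m (gpd_rng gamma) eta |)%:E.

(* Topological amenability of an etale groupoid in the sense of
   Anantharaman-Delaroche and Renault: there is a net (here: a family indexed
   along a proper filter) of continuous systems of probability measures for the
   range map which is asymptotically invariant, uniformly on compact sets. *)
Definition amenable : Prop :=
  exists (I : Type) (F : set_system I) (m : I -> X -> A -> R),
    [/\ ProperFilter F,
        forall i, prob_system (m i) /\ cont_system (m i) &
        forall K : set A, compact K -> K `<=` gpd_arrow Gd ->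
          forall e : R, 0 < e ->
            \forall i \near F, forall gamma, K gamma ->
              (translation_defect (m i) gamma < e%:E)%E].

End Amenability.

(* The groupoid of a partial action of the discrete group G, restricted to Y;
   dom g is the domain of act g.  The arrow (g, x) goes from x to g.x. *)
Definition partial_trans_groupoid (G : groupType) (X : topologicalType)
    (dom : G -> set X) (act : G -> X -> X) (Y : set X) : top_groupoid :=
  @TopGroupoid (discrete_topology G * X)%type X
    [set a | (dom a.1 `&` Y) a.2]
    Y
    (fun a => a.2)
    (fun a => act a.1 a.2)
    (fun a b => ((a.1 : G) * (b.1 : G), b.2))
    (fun a => ((a.1 : G)^-1, act a.1 a.2)).

Definition artin_groupoid (S : finType) (m : S -> S -> nat) : top_groupoid :=
  @partial_trans_groupoid (artin_group m) _
    (@paction_dom S (artin_rel m)) (@paction S (artin_rel m))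
    (@Omega_tilde S (artin_rel m)).

(* Main.v *)
Require Import Defs.
From mathcomp Require Import all_boot all_order all_algebra.
From mathcomp Require Import all_classical all_reals all_analysis.
From mathcomp Require Import ring lra zify.

(** Let [s] and [t] be generators with [m s t > 2], and let [chi] be the character
    whose value at [xP] is one exactly when [x] lies in the submonoid generated by
    [s] and [t] ([par_char]). It belongs to the unit space, because that submonoid
    has no greatest element and there is a third generator, and it is fixed by the
    dihedral Artin group generated by [s] and [t] ([par_char_fixed]). This group
    acts on the fiber over [chi] by left multiplication ([par_char_stable]), so an
    asymptotically invariant system of probability measures yields a probability
    on the fiber that the cubes of [s] and of [t] move by less than 1/2. On the
    other hand the fiber has an equivariant map to a punctured plane on which the
    two cubes play ping-pong ([cube_attracts]): each of them comes with two regions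
    that must carry more than half of the mass ([mass_pingpong]), and the four
    regions are disjoint.

    All that has to be known about Artin groups is read off one family of linear
    representations [burau], with a parameter [v].

    As [v] tends to 0, the generators tend to commuting coordinate projections.
    Hence the set of letters of a positive word depends only on the group element
    that it represents ([iota_support]). This decides membership in the
    parabolic submonoid, and replaces the embedding of the monoid in the group.

    At [v = 1] the representation is the contragredient of the geometric
    representation of the Coxeter group. The elements of the monoid that can be
    played in the associated numbers game are its simple elements; they are
    determined by their chambers ([pos_inj]), and any two letters dividing one of
    them have their least common multiple [delta] dividing it ([simple_delta]).
    From this the monoid is shown to be right LCM ([artin_lcm]): it acts on pairs
    consisting of a simple element and an arbitrary one, in such a way that the
    image of the trivial pair under [p] is the factorization of [p] by its greatest
    simple left divisor, and the action can be undone one letter at a time, which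
    gives left cancellation ([gen_mulI]). The LCM property is what makes the
    partial action on abstract characters well behaved.

    At [v = 1/2] the generators [s] and [t] act on the plane of their two
    coordinates as hyperbolic maps with four distinct fixed lines, since
    [m s t > 2]. *)

Set Implicit Arguments.
Unset Strict Implicit.
Unset Printing Implicit Defensive.

Import Order.TTheory GRing.Theory Num.Theory.

Local Open Scope classical_set_scope.
Local Open Scope ring_scope.

(** * Words, presented monoids and their actions *)

Section PresentedMonoid.
Variables (X : choiceType) (R : seq X -> seq X -> Prop).

Local Notation P := (pres_monoid R).

Definition gen (x : X) : P := pres_class R [:: x].

Lemma pres_class_cat u v :
  pres_class R (u ++ v) = (pres_class R u * pres_class R v)%g.
Proof. by rewrite -pres_mulE. Qed.

Lemma pres_class_nil : pres_class R [::] = 1%g :> P.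
Proof. by []. Qed.

Lemma pres_class_cons x u : pres_class R (x :: u) = (gen x * pres_class R u)%g.
Proof. exact: (pres_class_cat [:: x]). Qed.

Lemma pres_ind (Q : P -> Prop) :
  Q 1%g -> (forall x p, Q p -> Q (gen x * p)%g) -> forall p, Q p.
Proof.
move=> Q1 QM p; rewrite -(pres_reprK p); elim: (repr p) => [//|x u ih].
by rewrite pres_class_cons; exact: QM.
Qed.

(** Words act on the left: the last letter acts first. *)
Definition pact (T : Type) (f : X -> T -> T) (p : P) (a : T) : T :=
  foldr f a (repr p).

Section Action.
Variables (T : Type) (f : X -> T -> T).
Hypothesis fR : forall u v, R u v -> forall a, foldr f a u = foldr f a v.

Lemma word_cong_foldr u v : word_cong R u v -> forall a, foldr f a u = foldr f a v.
Proof.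
elim=> {u v}.
- by move=> l u v r /fR uv a; rewrite !foldr_cat uv.
- by [].
- by move=> u v _ ih a; rewrite ih.
- by move=> u v w _ uv _ vw a; rewrite uv.
Qed.

Lemma pactE u a : pact f (pres_class R u) a = foldr f a u.
Proof. by apply: word_cong_foldr; exact: repr_pres_class. Qed.

Lemma pact1 a : pact f 1%g a = a.
Proof. by rewrite -pres_class_nil pactE. Qed.

Lemma pactM p q a : pact f (p * q)%g a = pact f p (pact f q a).
Proof.
rewrite -(pres_reprK p) -(pres_reprK q) -pres_class_cat !pactE.
by rewrite foldr_cat.
Qed.

Lemma pact_gen x a : pact f (gen x) a = f x a.
Proof. by rewrite pactE. Qed.

Lemma pact_genM x p a : pact f (gen x * p)%g a = f x (pact f p a).
Proof. by rewrite pactM pact_gen. Qed.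

End Action.

End PresentedMonoid.

Lemma alt_wordS (T : Type) (s t : T) n :
  alt_word s t n.+1 = s :: alt_word t s n.
Proof.
rewrite /alt_word /mkseq /= -[1%N]/(1 + 0)%N iotaDl -map_comp; congr cons.
by apply: eq_map => i /=; case: (odd i).
Qed.

Lemma alt_wordSr (T : Type) (s t : T) n :
  alt_word s t n.+1 = rcons (alt_word s t n) (if odd n then t else s).
Proof. by rewrite /alt_word mkseqS. Qed.

Lemma size_alt_word (T : Type) (s t : T) n : size (alt_word s t n) = n.
Proof. exact: size_mkseq. Qed.

Lemma rev_alt_word (T : Type) (s t : T) n :
  rev (alt_word s t n) = if odd n then alt_word s t n else alt_word t s n.
Proof.
elim: n s t => [//|n ih] s t.
rewrite [in LHS]alt_wordS rev_cons ih.
by rewrite (alt_wordSr s t) (alt_wordSr t s) /=; case: (odd n).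
Qed.

Lemma foldr_alt_wordS (T A : Type) (f : T -> A -> A) a (s t : T) n :
  foldr f a (alt_word s t n.+1) = f s (foldr f a (alt_word t s n)).
Proof. by rewrite alt_wordS. Qed.

(** * A deformation of the reflection representation *)

Section Chebyshev.
Variables (R : realType) (n : nat).
Hypothesis n_gt1 : (1 < n)%N.

Let theta : R := pi / n%:R.

(** The bilinear form of the geometric representation has off-diagonal entries
    [- kappa / 2], and [cheb j] is the value at [kappa / 2] of the Chebyshev
    polynomial of the second kind of degree [j - 1]; these polynomials govern the
    powers of a product of two reflections. *)
Definition kappa : R := 2 * cos theta.

Definition cheb (j : nat) : R := sin (j%:R * theta) / sin theta.

Let n_gt0 : 0 < n%:R :> R.
Proof. by rewrite ltr0n ltnW. Qed.

Let n_theta : n%:R * theta = pi.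
Proof. by rewrite mulrC divfK// gt_eqF. Qed.

Let sin_theta_gt0 (j : nat) : (0 < j < n)%N -> 0 < sin (j%:R * theta).
Proof.
move=> /andP[j0 jn]; apply: sin_gt0_pi; rewrite mulr_gt0 ?ltr0n//=; last first.
  by rewrite divr_gt0 ?pi_gt0.
by rewrite -n_theta ltr_pM2r ?ltr_nat// divr_gt0 ?pi_gt0.
Qed.

Let sin1_gt0 : 0 < sin theta.
Proof. by have := @sin_theta_gt0 1; rewrite mul1r; apply. Qed.

Lemma cheb0 : cheb 0 = 0.
Proof. by rewrite /cheb mul0r sin0 mul0r. Qed.

Lemma cheb1 : cheb 1 = 1.
Proof. by rewrite /cheb mul1r divff// gt_eqF. Qed.

Lemma chebSS j : cheb j.+2 = kappa * cheb j.+1 - cheb j.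
Proof.
rewrite /cheb /kappa mulrA -mulrBl; congr (_ / _).
have -> : j.+2%:R * theta = j.+1%:R * theta + theta by rewrite -natr1; ring.
have -> : j%:R * theta = j.+1%:R * theta - theta by rewrite -natr1; ring.
by rewrite sinD sinB; ring.
Qed.

Lemma cheb_n : cheb n = 0.
Proof. by rewrite /cheb n_theta sinpi mul0r. Qed.

Lemma cheb_pred : cheb n.-1 = 1.
Proof.
rewrite /cheb; have -> : n.-1%:R * theta = pi - theta.
  by rewrite -n_theta -[in RHS](prednK (ltnW n_gt1)) -natr1; ring.
by rewrite sinB sinpi cospi mul0r sub0r mulN1r opprK divff// gt_eqF.
Qed.

Lemma cheb_gt0 j : (0 < j < n)%N -> 0 < cheb j.
Proof. by move=> jn; rewrite divr_gt0 ?sin_theta_gt0. Qed.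

Lemma cheb_ge0 j : (j <= n)%N -> 0 <= cheb j.
Proof.
case: j => [|j]; first by rewrite cheb0.
rewrite leq_eqVlt => /predU1P[->|jn]; first by rewrite cheb_n.
by rewrite ltW ?cheb_gt0.
Qed.

Lemma kappaE : kappa = cheb 2.
Proof. by rewrite chebSS cheb0 cheb1; ring. Qed.

Lemma kappa_sqr_lt4 : kappa ^+ 2 < 4.
Proof.
have h := cos2Dsin2 theta; have : 0 < sin theta ^+ 2 by rewrite exprn_gt0.
rewrite /kappa; nra.
Qed.

(** [cheb 3 = kappa ^ 2 - 1] is nonnegative and [kappa] positive. *)
Lemma kappa_ge1 : (2 < n)%N -> 1 <= kappa.
Proof.
move=> n2; have k0 : 0 < kappa by rewrite kappaE cheb_gt0.
have := cheb_ge0 n2; rewrite chebSS -kappaE cheb1; nra.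
Qed.

End Chebyshev.

(** In a space with basis the simple roots [e s] and a bilinear form [B] with
    [B (e s) (e s) = 1 + v ^ 2] and [B (e s) (e r) = - v * c s r], this is the
    operator [x - B x (e s) * e s], written in the coordinates [x r = B x (e r)].
    Its eigenvalues are 1 and [- v ^ 2], so this is the reflection representation
    of the Iwahori-Hecke algebra with parameter [v ^ 2]; at [v = 1] it is that of
    the Coxeter group. The ring is arbitrary because the parameter is also taken
    to be a polynomial variable. *)
Definition burau (A : comNzRingType) (S : eqType) (c : S -> S -> A) (v : A)
    (s : S) (x : S -> A) : S -> A :=
  fun r => if r == s then - v ^+ 2 * x s else x r + v * c s r * x s.

Section Burau.
Variables (R : realType) (S : finType) (m : S -> S -> nat).
Hypothesis cm : coxeter_matrix m.

Lemma coxeter_diag s : m s s = 1%N. Proof. by case: cm. Qed.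
Lemma coxeter_sym s t : m s t = m t s. Proof. by case: cm. Qed.
Lemma coxeter_gt1 s t : s != t -> (1 < m s t)%N. Proof. by case: cm => _ _; apply. Qed.

Definition ckappa (s t : S) : R := kappa R (m s t).

Local Notation T := (burau ckappa).

Lemma ckappa_sym s t : ckappa s t = ckappa t s.
Proof. by rewrite /ckappa coxeter_sym. Qed.

Lemma burau_diag v s x : T v s x s = - v ^+ 2 * x s.
Proof. by rewrite /burau eqxx. Qed.

Lemma burau_off v s r x : r != s -> T v s x r = x r + v * ckappa s r * x s.
Proof. by rewrite /burau => /negbTE ->. Qed.

(** After [n] steps of an alternating product, this is the coordinate that the
    next step will modify, if initially the coordinate at the first letter to act
    is [a] and the other one is [b]. The predecessor is harmless at [n = 0], where
    [cheb 0 = 0]. *)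
Definition alt_coord (v : R) (k n : nat) (a b : R) : R :=
  v ^+ n * cheb R k n.+1 * a + v ^+ n.-1 * cheb R k n * b.

(** The rightmost letter acts first; whether it is [s] or [t] depends on the
    parity of [n]. The induction is on two consecutive values of [n], following
    the recurrence of [cheb]. *)
Lemma burau_alt v x n s t (st : s != t) :
  foldr (T v) x (alt_word s t n) t =
  alt_coord v (m s t) n (x (if odd n then s else t)) (x (if odd n then t else s)).
Proof.
have m1 := coxeter_gt1 st.
suff : forall s t : S, s != t -> forall k, k = m s t ->
   foldr (T v) x (alt_word s t n) t =
     alt_coord v k n (x (if odd n then s else t)) (x (if odd n then t else s)) /\
   foldr (T v) x (alt_word s t n.+1) t = alt_coord v k n.+1
     (x (if odd n then t else s)) (x (if odd n then s else t)).
  by move=> /(_ s t st _ erefl) [].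
elim: n {s t st m1} => [|n ih] s t st k km; have ts : t != s by rewrite eq_sym.
  have k1 : (1 < k)%N by rewrite km coxeter_gt1.
  rewrite foldr_alt_wordS burau_off//.
  by rewrite /alt_coord /ckappa -km /= !chebSS// cheb0 cheb1//; split; ring.
have k1 : (1 < k)%N by rewrite km coxeter_gt1.
have [_ h1] := ih s t st k km.
have [g0 _] := ih s t st k km.
have [_ g1] := ih t s ts k (etrans km (coxeter_sym s t)).
split; first by rewrite h1 /=; case: odd.
rewrite foldr_alt_wordS burau_off// g1.
rewrite foldr_alt_wordS burau_diag g0 /ckappa -km.
case: n {ih h1 g0 g1} => [|n]; rewrite /alt_coord.
  by rewrite /= !chebSS// cheb0 cheb1//; ring.
rewrite [cheb R k n.+4]chebSS// [cheb R k n.+3]chebSS// /= !negbK.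
by case: odd; rewrite !exprS; ring.
Qed.

Lemma burau_alt_m v x s t (st : s != t) :
  foldr (T v) x (alt_word s t (m s t)) t =
    - v ^+ m s t * x (if odd (m s t) then s else t) /\
  foldr (T v) x (alt_word s t (m s t)) s =
    - v ^+ m s t * x (if odd (m s t) then t else s).
Proof.
have m1 := coxeter_gt1 st; have m0 := ltnW m1.
have ts : t != s by rewrite eq_sym.
split.
  rewrite burau_alt// /alt_coord cheb_n//.
  have -> : cheb R (m s t) (m s t).+1 = -1.
    rewrite -{2}(prednK m0) chebSS// (prednK m0) cheb_n// cheb_pred//; ring.
  by ring.
rewrite -{1 2 3}(prednK m0) foldr_alt_wordS burau_diag burau_alt//.
rewrite -(coxeter_sym s t) /alt_coord (prednK m0) cheb_n// cheb_pred//.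
rewrite -[in odd (m s t)](prednK m0) /=.
case: (m s t) m1 => [|[|k]]//= _; rewrite !exprS; case: odd => /=; ring.
Qed.

Lemma burau_foldr_invariant v x (f : (S -> R) -> R) (w : seq S) :
  (forall s y, s \in w -> f (T v s y) = f y) -> f (foldr (T v) x w) = f x.
Proof.
elim: w => [//|s w ih] fs /=; rewrite fs ?mem_head// ih// => t y tw.
by rewrite fs// in_cons tw orbT.
Qed.

Lemma mem_alt_word (s t r : S) n : r \in alt_word s t n -> (r == s) || (r == t).
Proof.
elim: n s t => [//|n ih] s t; rewrite alt_wordS in_cons => /orP[->//|/ih].
by rewrite orbC.
Qed.

(** On the plane of the coordinates [s] and [t] both alternating products are
    [- v ^ m] times the identity or the swap. The other coordinates follow
    because each of them can be corrected by a combination of the coordinates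
    [s] and [t] to a function invariant under both generators. *)
Lemma burau_braid v s t x : v != 0 ->
  foldr (T v) x (alt_word s t (m s t)) = foldr (T v) x (alt_word t s (m s t)).
Proof.
move=> v0; have [->//|st] := eqVneq s t.
have ts : t != s by rewrite eq_sym.
set y := LHS; set z := RHS.
have yzt : y t = z t.
  rewrite /y /z (burau_alt_m v x st).1.
  by rewrite coxeter_sym (burau_alt_m v x ts).2.
have yzs : y s = z s.
  rewrite /y /z (burau_alt_m v x st).2.
  by rewrite coxeter_sym (burau_alt_m v x ts).1.
have k4 : ckappa s t ^+ 2 < 4 by rewrite kappa_sqr_lt4// coxeter_gt1.
(* The correction coefficients [a] and [b] below solve a linear system with
   determinant [e ^ 2 - k ^ 2], nonzero because [kappa < 2]. *)
pose k := v * ckappa s t; pose e := 1 + v ^+ 2.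
have d0 : e ^+ 2 - k ^+ 2 != 0.
  have v2 : 0 < v ^+ 2 by rewrite exprn_even_gt0.
  rewrite gt_eqF// subr_gt0 /k /e exprMn.
  move: (v ^+ 2) (ckappa s t ^+ 2) v2 k4 => w c w0 c4.
  have := sqr_ge0 (1 - w); have : c * w < 4 * w by rewrite ltr_pM2r.
  lra.
apply/funext => r; have [->//|rs] := eqVneq r s; have [->//|rt] := eqVneq r t.
pose a := (e * (v * ckappa s r) + k * (v * ckappa t r)) / (e ^+ 2 - k ^+ 2).
pose b := (e * (v * ckappa t r) + k * (v * ckappa s r)) / (e ^+ 2 - k ^+ 2).
pose f (x : S -> R) := x r + a * x s + b * x t.
have fT u w : (u == s) || (u == t) -> f (T v u w) = f w.
  move=> /orP[] /eqP->; rewrite /f burau_diag !burau_off// ?(ckappa_sym t s) -/k.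
    have -> : v * ckappa s r = a * e - b * k by rewrite /a /b; field.
    by rewrite /e; ring.
  have -> : v * ckappa t r = b * e - a * k by rewrite /a /b; field.
  by rewrite /e; ring.
have : f y = f z.
  rewrite /y /z !burau_foldr_invariant// => u w /mem_alt_word; last exact: fT.
  by rewrite orbC; exact: fT.
by rewrite /f yzs yzt => /addIr /addIr.
Qed.

End Burau.

(** * The support of a positive element of the Artin group *)

Section GroupAction.
Variables (R : realType) (S : finType) (m : S -> S -> nat).
Hypothesis cm : coxeter_matrix m.

Local Notation P := (artin_monoid m).
Local Notation G := (artin_group m).
Local Notation iota := (@monoid_to_group S (artin_rel m)).
Local Notation T := (burau (ckappa R m)).

Definition burau_inv (v : R) (s : S) (x : S -> R) : S -> R :=
  fun r => if r == s then - x s / v ^+ 2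
           else x r + v * ckappa R m s r * x s / v ^+ 2.

Lemma burauK v s : v != 0 -> cancel (T v s) (burau_inv v s).
Proof.
move=> v0 x; apply/funext => r; rewrite /burau_inv burau_diag.
by have [->|rs] := eqVneq r s; [|rewrite burau_off//]; field.
Qed.

Lemma burau_invK v s : v != 0 -> cancel (burau_inv v s) (T v s).
Proof.
move=> v0 x; apply/funext => r; rewrite /burau /burau_inv eqxx.
by case: eqP => [->|_]; field.
Qed.

Definition burau_letter (v : R) (a : S * bool) : (S -> R) -> (S -> R) :=
  if a.2 then T v a.1 else burau_inv v a.1.

Lemma foldr_pos_word v x (u : seq S) :
  foldr (burau_letter v) x (pos_word u) = foldr (T v) x u.
Proof. by elim: u => //= s u ->. Qed.

Lemma artin_rel_burau v : v != 0 -> forall u w, artin_rel m u w ->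
  forall x, foldr (T v) x u = foldr (T v) x w.
Proof. by move=> v0 u w [s t] x; exact: burau_braid. Qed.

Lemma group_rel_burau v : v != 0 -> forall u w, group_rel (artin_rel m) u w ->
  forall x, foldr (burau_letter v) x u = foldr (burau_letter v) x w.
Proof.
move=> v0 u w [{}u {}w uw|[s []]] x /=.
- by rewrite !foldr_pos_word; exact: artin_rel_burau.
- exact: burau_invK.
- exact: burauK.
Qed.

Definition gact (v : R) (g : G) : (S -> R) -> (S -> R) := pact (burau_letter v) g.

Definition mact (v : R) (p : P) : (S -> R) -> (S -> R) := pact (T v) p.

Lemma gactM v g h x : v != 0 -> gact v (g * h)%g x = gact v g (gact v h x).
Proof. by move=> v0; apply: pactM; exact: group_rel_burau. Qed.

Lemma gact1 v x : v != 0 -> gact v 1%g x = x.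
Proof. by move=> v0; apply: pact1; exact: group_rel_burau. Qed.

Lemma gact_iota v p x : v != 0 -> gact v (iota p) x = mact v p x.
Proof.
move=> v0; rewrite -(pres_reprK p) monoid_to_groupE /gact pactE; last first.
  exact: group_rel_burau.
by rewrite foldr_pos_word /mact pactE//; exact: artin_rel_burau.
Qed.

(** At parameter zero the operators become the commuting projections killing
    one coordinate, so a word kills exactly the coordinates of its letters. *)
Lemma burau0_foldr (u : seq S) r : foldr (T 0) (fun=> 1) u r = (r \notin u)%:R.
Proof.
elim: u r => [//|s u ih] r /=; rewrite /burau in_cons !ih negb_or.
by case: eqP => _ /=; ring.
Qed.

Lemma burau_horner v (u : seq S) (y : S -> {poly R}) r :
  (foldr (burau (fun s t => (ckappa R m s t)%:P) 'X) y u r).[v] =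
  foldr (T v) (fun r => (y r).[v]) u r.
Proof.
elim: u r => [//|s u ih] r /=; rewrite /burau; case: ifP => _; rewrite !hornerE.
  by rewrite ih.
by rewrite !ih.
Qed.

Lemma poly_eq_off0 (p q : {poly R}) :
  (forall v, v != 0 -> p.[v] = q.[v]) -> p = q.
Proof.
move=> pq; apply/eqP; rewrite -subr_eq0; apply/eqP.
apply: (@roots_geq_poly_eq0 R (p - q) [seq i.+1%:R | i <- seq.iota 0 (size (p - q))]).
- apply/allP => _ /mapP[i _ ->]; rewrite /root !hornerE pq ?subrr//.
- rewrite map_inj_uniq ?seq.iota_uniq// => i j /eqP.
  by rewrite eqr_nat => /eqP[].
- by rewrite size_map size_iota.
Qed.

(** Two positive words with the same image in the group give operators that
    agree at every nonzero parameter; their coefficients are polynomials in the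
    parameter, so the operators also agree at zero, where the letters of the
    word can be read off. *)
Lemma pos_word_support (u w : seq S) :
  pres_class (group_rel (artin_rel m)) (pos_word u) =
    pres_class (group_rel (artin_rel m)) (pos_word w) -> u =i w.
Proof.
move=> uw r.
have uwv v : v != 0 -> foldr (T v) (fun=> 1) u = foldr (T v) (fun=> 1) w.
  move=> v0; rewrite -!foldr_pos_word.
  by apply: (word_cong_foldr (group_rel_burau v0)); exact/pres_classP.
pose F (u : seq S) := foldr (burau (fun s t => (ckappa R m s t)%:P) 'X) (fun=> 1) u r.
have Fv u0 v : (F u0).[v] = foldr (T v) (fun=> 1) u0 r.
  rewrite burau_horner; congr (foldr _ _ _ _).
  by apply/funext => ?; rewrite hornerE.
have Fuw : F u = F w by apply: poly_eq_off0 => v v0; rewrite !Fv uwv.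
have /eqP := congr1 (fun p => p.[0]) Fuw.
by rewrite !Fv !burau0_foldr eqr_nat; case: (r \in u); case: (r \in w).
Qed.

Lemma iota_support p q : iota p = iota q -> repr p =i repr q.
Proof. exact: pos_word_support. Qed.

Lemma mem_repr_class (u : seq S) : repr (pres_class (artin_rel m) u) =i u.
Proof.
apply: pos_word_support; apply/pres_classP/word_cong_pos.
exact: repr_pres_class.
Qed.

End GroupAction.

(** * Simple elements: the numbers game *)

Section Simple.
Variables (R : realType) (S : finType) (m : S -> S -> nat).
Hypothesis cm : coxeter_matrix m.

Local Notation P := (artin_monoid m).
Local Notation T := (burau (ckappa R m)).
Local Notation gen := (gen (artin_rel m)).
Local Notation cls := (pres_class (artin_rel m)).

Definition plen (p : P) : nat := size (repr p).

Lemma plen_class u : plen (cls u) = size u.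
Proof.
have szE n (w : seq S) : foldr (fun=> succn) n w = (size w + n)%N.
  by elim: w => //= ? ? ->.
rewrite /plen -[LHS]addn0 -[RHS]addn0 -!szE.
apply: (word_cong_foldr _ (repr_pres_class _ u)) => _ _ [s t] n.
by rewrite !szE !size_alt_word.
Qed.

Lemma plen1 : plen 1%g = 0%N.
Proof. by rewrite -pres_class_nil plen_class. Qed.

Lemma plenM p q : plen (p * q)%g = (plen p + plen q)%N.
Proof.
by rewrite -(pres_reprK p) -(pres_reprK q) -pres_class_cat !plen_class size_cat.
Qed.

Lemma plen_gen s : plen (gen s) = 1%N.
Proof. by rewrite plen_class. Qed.

Lemma plen_eq0 p : plen p = 0%N -> p = 1%g.
Proof. by move=> /size0nil p0; rewrite -(pres_reprK p) p0. Qed.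

Lemma P_case p : p = 1%g \/ exists s q, p = (gen s * q)%g.
Proof. by elim/pres_ind: p => [|s p _]; [left|right; exists s, p]. Qed.

Definition ldvd (p q : P) : Prop := exists r, q = (p * r)%g.

Lemma ldvd_refl p : ldvd p p. Proof. by exists 1%g; rewrite mulg1. Qed.

Lemma ldvd_trans q p r : ldvd p q -> ldvd q r -> ldvd p r.
Proof. by move=> [a ->] [b ->]; exists (a * b)%g; rewrite mulgA. Qed.

Lemma ldvd_mul2l c p q : ldvd p q -> ldvd (c * p)%g (c * q)%g.
Proof. by move=> [a ->]; exists a; rewrite mulgA. Qed.

Lemma ldvd_mulr p q : ldvd p (p * q)%g. Proof. by exists q. Qed.

Lemma ldvd_anti p q : ldvd p q -> ldvd q p -> p = q.
Proof.
move=> [a ->] [b pab]; have /(congr1 plen) := pab.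
rewrite !plenM => ab0; rewrite (@plen_eq0 a) ?mulg1//; lia.
Qed.

Definition delta (s t : S) : P := cls (alt_word s t (m s t)).

Lemma delta_sym s t : delta s t = delta t s.
Proof.
rewrite /delta (coxeter_sym cm t s); apply/pres_classP.
by have := word_cong_rel [::] [::] (artin_rel_braid m s t); rewrite /= !cats0.
Qed.

Lemma ldvd_gen_delta s t : ldvd (gen s) (delta s t).
Proof.
have m0 : (0 < m s t)%N.
  by have [->|/(coxeter_gt1 cm)/ltnW//] := eqVneq s t; rewrite coxeter_diag.
rewrite /delta -(prednK m0) alt_wordS pres_class_cons; exact: ldvd_mulr.
Qed.

(** In the numbers game a move at [s] applies the reflection of [s] to a vector,
    and is legal when it makes a positive coordinate negative, that is, when it
    moves a chamber of the Tits cone away from the fundamental one. The boolean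
    records whether all moves so far were legal; as both sides of a braid relation
    are legal from the same vectors, it makes sense on the monoid. *)
Definition game_move (s : S) (xb : (S -> R) * bool) : (S -> R) * bool :=
  (T 1 s xb.1, xb.2 && (0 < xb.1 s)).

Fixpoint legal_word (u : seq S) (x : S -> R) : bool :=
  if u is s :: u' then legal_word u' x && (0 < foldr (T 1) x u' s) else true.

Lemma foldr_game_move u x b :
  foldr game_move (x, b) u = (foldr (T 1) x u, b && legal_word u x).
Proof. by elim: u => [|s u /= ->]; rewrite /game_move /= ?andbT// andbA. Qed.

Lemma alt_coord_gt0 s t n (a b : R) : s != t -> (n < m s t)%N -> 0 < a -> 0 < b ->
  0 < alt_coord 1 (m s t) n a b.
Proof.
move=> st nm a0 b0; have m1 := coxeter_gt1 cm st.
rewrite /alt_coord !expr1n !mul1r; case: n nm => [|n] nm.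
  by rewrite cheb0 cheb1// mul0r addr0 mul1r.
apply: ltr_wpDl; first by apply: mulr_ge0; [exact: cheb_ge0|exact: ltW].
by apply: mulr_gt0 => //; exact: cheb_gt0.
Qed.

Lemma legal_alt s t n x : s != t -> (n <= m s t)%N -> 0 < x s -> 0 < x t ->
  legal_word (alt_word s t n) x.
Proof.
elim: n s t => [//|n ih] s t st nm xs xt; have ts : t != s by rewrite eq_sym.
have mts : m t s = m s t by rewrite (coxeter_sym cm).
rewrite alt_wordS /= ih ?mts ?(ltnW nm)// burau_alt//.
by apply: alt_coord_gt0; rewrite ?mts//; case: odd.
Qed.

Lemma legal_alt_first s t n x : legal_word (alt_word s t n.+1) x ->
  0 < x (if odd n then t else s).
Proof.
elim: n s t => [//|n ih] s t; rewrite alt_wordS => /andP[/ih] /=.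
by case: odd.
Qed.

(** The first and the last move of the product modify the initial coordinates at
    the two letters, and all other moves positive combinations of them. *)
Lemma legal_alt_m s t x : s != t ->
  legal_word (alt_word s t (m s t)) x = (0 < x s) && (0 < x t).
Proof.
move=> st; have ts : t != s by rewrite eq_sym.
have m1 := coxeter_gt1 cm st; have m0 := ltnW m1.
apply/idP/andP => [|[]]; last exact: legal_alt.
rewrite -(prednK m0) => L; have := legal_alt_first L; move: L.
rewrite alt_wordS /= => /andP[_]; rewrite burau_alt//.
rewrite /alt_coord -(coxeter_sym cm s t) (prednK m0) cheb_n// cheb_pred// !expr1n.
by case: odd => h1 h2; split=> //; move: h1; rewrite !(mulr0, mul0r, mul1r, add0r).
Qed.

Lemma artin_rel_game_move u w : artin_rel m u w ->
  forall xb, foldr game_move xb u = foldr game_move xb w.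
Proof.
move=> [s t] [x b]; have [->//|st] := eqVneq s t.
have ts : t != s by rewrite eq_sym.
rewrite !foldr_game_move (burau_braid cm s t x (oner_neq0 R)).
rewrite legal_alt_m// (coxeter_sym cm s t) legal_alt_m//.
by rewrite [(0 < x t) && _]andbC.
Qed.

Definition pos (p : P) : S -> R := mact 1 p (fun=> 1).

Definition legal (p : P) (x : S -> R) : bool := (pact game_move p (x, true)).2.

(** The legal plays from the all-ones vector are the reduced words, so the simple
    elements are the canonical lifts of the elements of the Coxeter group. *)
Definition simple (p : P) : bool := legal p (fun=> 1).

Let one_neq0 : (1 : R) != 0. Proof. exact: oner_neq0. Qed.

Lemma mactM p q x : mact (R := R) (m := m) 1 (p * q)%g x = mact 1 p (mact 1 q x).
Proof. exact: (pactM (artin_rel_burau cm one_neq0)). Qed.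

Lemma mact_class u x : mact (R := R) (m := m) 1 (cls u) x = foldr (T 1) x u.
Proof. exact: (pactE (artin_rel_burau cm one_neq0)). Qed.

Lemma mact_gen s x : mact (R := R) (m := m) 1 (gen s) x = T 1 s x.
Proof. exact: mact_class. Qed.

Lemma posM p q : pos (p * q)%g = mact 1 p (pos q).
Proof. exact: mactM. Qed.

Lemma pos1 : pos 1%g = fun=> 1.
Proof. exact: (pact1 (artin_rel_burau cm one_neq0)). Qed.

Lemma legal_class u x : legal (cls u) x = legal_word u x.
Proof. by rewrite /legal (pactE artin_rel_game_move) foldr_game_move. Qed.

Lemma pact_game_move p x b : pact game_move p (x, b) = (mact 1 p x, b && legal p x).
Proof.
rewrite -(pres_reprK p) legal_class mact_class (pactE artin_rel_game_move).
exact: foldr_game_move.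
Qed.

Lemma simpleM p q : simple (p * q)%g = simple q && legal p (pos q).
Proof.
by rewrite /simple /legal (pactM artin_rel_game_move) pact_game_move pact_game_move.
Qed.

Lemma simple_gen_mul s p : simple (gen s * p)%g = simple p && (0 < pos p s).
Proof. by rewrite simpleM legal_class. Qed.

Lemma simple1 : simple 1%g.
Proof. by rewrite /simple -pres_class_nil legal_class. Qed.

Lemma simple_gen s : simple (gen s).
Proof. by rewrite -[gen s]mulg1 simple_gen_mul simple1 pos1 ltr01. Qed.

Lemma simple_mulr p q : simple (p * q)%g -> simple q.
Proof. by rewrite simpleM => /andP[]. Qed.

Lemma pos_genM s p : pos (gen s * p)%g = T 1 s (pos p).
Proof. by rewrite posM mact_gen. Qed.

(** If [p] starts with [t] and its coordinate at [s] is not positive, strip from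
    [p] the longest alternating prefix in [s] and [t]: had it fewer than
    [m s t] letters, both coordinates of what is left would be positive, and so
    would every coordinate met by the alternating product before its last
    step. *)
Lemma simple_delta_aux p y s t : s != t -> simple p -> p = (gen t * y)%g ->
  (forall w, simple w -> (plen w < plen p)%N -> forall r,
     pos w r != 0 /\ (pos w r < 0 -> ldvd (gen r) w)) ->
  pos p s <= 0 -> ldvd (delta t s) p.
Proof.
move=> st sp py ih ps; have ts : t != s by rewrite eq_sym.
have m1 := coxeter_gt1 cm ts; have m0 := ltnW m1.
pose Q n := (n <= m t s)%N && `[< ldvd (cls (alt_word t s n)) p >].
have Q1 : Q 1%N.
  by rewrite /Q m0; apply/asboolP; exists y; rewrite py.
have Qm n : Q n -> (n <= m t s)%N by case/andP.
have exQ : exists n, Q n by exists 1%N.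
have [n /andP[nm /asboolP[w pw]] nmax] := ex_maxnP exQ Qm.
move: nm; rewrite leq_eqVlt => /predU1P[nm|nm]; first by exists w; rewrite /delta -nm.
have n0 : (0 < n)%N := nmax _ Q1.
have := sp; rewrite pw simpleM legal_class => /andP[sw L].
have wp : (plen w < plen p)%N by rewrite pw plenM plen_class size_alt_word; lia.
set c := if odd n then s else t; set d := if odd n then t else s.
have wd : 0 < pos w d.
  move: L; rewrite -(prednK n0) => /legal_alt_first.
  by rewrite /d -{2}(prednK n0) /=; case: odd.
have wc : 0 < pos w c.
  have [c0 cneg] := ih _ sw wp c.
  rewrite lt_neqAle eq_sym c0 leNgt; apply/negP => /cneg [w' ww].
  suff /nmax : Q n.+1 by rewrite ltnn.
  rewrite /Q nm; apply/asboolP; exists w'.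
  by rewrite pw ww alt_wordSr -cats1 pres_class_cat mulgA.
move: ps; rewrite leNgt => /negP[].
by rewrite pw posM mact_class burau_alt// alt_coord_gt0.
Qed.

(** The exchange condition of Coxeter groups: the position lies in an open chamber,
    which is on the far side of the wall of [s] only if some play of [p] ends by
    crossing that wall. *)
Lemma simple_coord p : simple p -> forall s,
  pos p s != 0 /\ (pos p s < 0 -> ldvd (gen s) p).
Proof.
have [n] := ubnP (plen p); elim: n p => // n ih p pn sp s.
have [p1|[t [y py]]] := P_case p.
  by rewrite p1 pos1 oner_neq0; split=> //; rewrite ltNge ler01.
have ih' w : simple w -> (plen w < plen p)%N -> forall r,
    pos w r != 0 /\ (pos w r < 0 -> ldvd (gen r) w).
  by move=> sw wp; apply: ih => //; lia.
have [ts|ts] := eqVneq t s.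
  subst t; split; last by move=> _; exists y.
  have := sp; rewrite py simple_gen_mul => /andP[_ ys].
  by rewrite pos_genM burau_diag expr1n mulN1r oppr_eq0 gt_eqF.
have st : s != t by rewrite eq_sym.
have dv := simple_delta_aux st sp py ih'.
split; last first.
  move=> /ltW /dv; apply: ldvd_trans; rewrite delta_sym; exact: ldvd_gen_delta.
apply/eqP => ps0; have [|q pq] := dv; first by rewrite ps0.
have := sp; rewrite pq simpleM legal_class legal_alt_m// => /andP[_ /andP[qt qs]].
move: ps0; rewrite pq posM mact_class (burau_alt_m cm _ _ ts).1 expr1n mulN1r.
by move/eqP; rewrite oppr_eq0; case: odd; rewrite gt_eqF.
Qed.

Lemma simple_delta p s t : s != t -> simple p ->
  ldvd (gen s) p -> ldvd (gen t) p -> ldvd (delta s t) p.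
Proof.
move=> st sp [x px] [y py]; rewrite delta_sym.
apply: (simple_delta_aux st sp py); first by move=> w sw _; exact: simple_coord.
move: sp; rewrite px simple_gen_mul => /andP[_ xs].
by rewrite pos_genM burau_diag expr1n mulN1r oppr_le0 ltW.
Qed.

Lemma simple_ldvd_neg p s : simple p -> ldvd (gen s) p -> pos p s < 0.
Proof.
move=> sp [q pq]; move: sp; rewrite pq simple_gen_mul => /andP[_ qs].
by rewrite pos_genM burau_diag expr1n mulN1r oppr_lt0.
Qed.

Lemma burau1_inj s : injective (T 1 s).
Proof. exact: can_inj (burauK m s one_neq0). Qed.

(** A simple element is determined by its chamber: its first letters are the
    coordinates at which the position is negative. *)
Lemma pos_inj p q : simple p -> simple q -> pos p = pos q -> p = q.
Proof.
elim/pres_ind: p q => [|s p ih] q sp sq e.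
  have [//|[t [q' qq]]] := P_case q.
  have := @simple_ldvd_neg q t sq; rewrite -e pos1 qq => /(_ (ldvd_mulr _ _)).
  by rewrite ltNge ler01.
have : pos q s < 0 by rewrite -e; apply: simple_ldvd_neg => //; exact: ldvd_mulr.
have [_ h] := simple_coord sq s => /h[q' qq].
rewrite qq; congr (_ * _)%g; apply: ih.
- exact: simple_mulr sp.
- by move: sq; rewrite qq; exact: simple_mulr.
- by apply: (@burau1_inj s); rewrite -!pos_genM e qq.
Qed.

Lemma mact_inj p : injective (mact (R := R) (m := m) 1 p).
Proof.
elim/pres_ind: p => [|s p ih] x y.
  by rewrite /mact !(pact1 (artin_rel_burau cm one_neq0)).
by rewrite !mactM !mact_gen => /burau1_inj /ih.
Qed.

Lemma simple_cancel p q q' : simple (p * q)%g -> simple (p * q')%g ->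
  (p * q)%g = (p * q')%g -> q = q'.
Proof.
move=> spq spq' e; apply: pos_inj; [exact: simple_mulr spq|exact: simple_mulr spq'|].
by apply: (@mact_inj p); rewrite -!posM e.
Qed.

Lemma burau1_invol s x : T 1 s (T 1 s x) = x.
Proof.
apply/funext => r; have [->|rs] := eqVneq r s.
  by rewrite burau_diag burau_diag; ring.
by rewrite !(burau_off _ _ _ rs) burau_diag; ring.
Qed.

Definition mirror (p : P) : P := cls (rev (repr p)).

Lemma word_cong_rev u w :
  word_cong (artin_rel m) u w -> word_cong (artin_rel m) (rev u) (rev w).
Proof.
elim=> {u w}.
- move=> l u w r [s t]; rewrite !rev_cat -!catA !rev_alt_word.
  case: odd; last apply: word_cong_sym;
  exact: word_cong_rel (artin_rel_braid m s t).
- by move=> u; exact: word_cong_refl.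
- by move=> u w _; exact: word_cong_sym.
- by move=> u w z _ h _; exact: word_cong_trans h.
Qed.

Lemma mirror_class u : mirror (cls u) = cls (rev u).
Proof. by apply/pres_classP/word_cong_rev; exact: repr_pres_class. Qed.

Lemma mirrorM p q : mirror (p * q)%g = (mirror q * mirror p)%g.
Proof.
rewrite -(pres_reprK p) -(pres_reprK q) -pres_class_cat !mirror_class.
by rewrite rev_cat pres_class_cat.
Qed.

Lemma mirrorK : involutive mirror.
Proof. by move=> p; rewrite -(pres_reprK p) !mirror_class revK. Qed.

Lemma mirror_gen s : mirror (gen s) = gen s.
Proof. exact: mirror_class. Qed.

Lemma plen_mirror p : plen (mirror p) = plen p.
Proof. by rewrite -{1}(pres_reprK p) mirror_class plen_class size_rev. Qed.

Lemma mirror_delta s t : mirror (delta s t) = delta s t.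
Proof.
rewrite /delta mirror_class rev_alt_word; case: odd => //.
by rewrite -/(delta s t) delta_sym /delta (coxeter_sym cm t s).
Qed.

(** A reduced expression of the image of [p] in the Coxeter group: when a move is
    not legal, the simple element built so far starts with the same letter, and
    the two cancel since reflections are involutions. The same cancellation takes
    place in the reversed words. *)
Lemma simple_reduction p : exists q, [/\ simple q,
  forall x, mact (R := R) 1 p x = mact 1 q x,
  forall x, mact (R := R) 1 (mirror p) x = mact 1 (mirror q) x,
  (plen q <= plen p)%N &
  simple p \/ (plen q < plen p)%N].
Proof.
elim/pres_ind: p => [|s p [q [sq pq rpq lq hp]]].
  by exists 1%g; split=> //; [exact: simple1|left; exact: simple1].
have pqpos : pos p = pos q by rewrite /pos pq.
have [q0 qneg] := simple_coord sq s.
have [qs|qs|qs] := ltrgtP 0 (pos q s); last by rewrite -qs eqxx in q0.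
- exists (gen s * q)%g; split.
  + by rewrite simple_gen_mul sq.
  + by move=> x; rewrite !mactM pq.
  + by move=> x; rewrite !mirrorM !mactM rpq.
  + by rewrite !plenM leq_add2l.
  + case: hp => [sp|lt]; last by right; rewrite !plenM ltn_add2l.
    by left; rewrite simple_gen_mul sp pqpos.
- have [q' qq] := qneg qs; exists q'; split.
  + by move: sq; rewrite qq; exact: simple_mulr.
  + by move=> x; rewrite mactM pq qq mactM !mact_gen burau1_invol.
  + move=> x; rewrite !mirrorM !mactM rpq qq mirrorM mactM !mirror_gen !mact_gen.
    by rewrite burau1_invol.
  + by move: lq; rewrite qq !plenM plen_gen; lia.
  + by right; move: lq; rewrite qq !plenM plen_gen; lia.
Qed.

(** Otherwise [mirror p] would have a shorter reduced expression, and reversing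
    that would shorten [p]. *)
Lemma simple_mirror p : simple p -> simple (mirror p).
Proof.
move=> sp; have [y [_ _ ry _ [//|yp]]] := simple_reduction (mirror p).
have [z [sz yz _ lz _]] := simple_reduction (mirror y).
have zp : z = p by apply: pos_inj => //; rewrite /pos -yz -ry mirrorK.
by move: lz yp; rewrite zp !plen_mirror; lia.
Qed.

Lemma simple_mull p q : simple (p * q)%g -> simple p.
Proof.
move=> /simple_mirror; rewrite mirrorM => /simple_mulr /simple_mirror.
by rewrite mirrorK.
Qed.

(** Reversed, this says that from a vector with positive coordinates at [s] and
    [t] the alternating product of length [m s t] is a legal play. *)
Lemma simple_mul_delta u s t : s != t ->
  simple (u * gen s)%g -> simple (u * gen t)%g -> simple (u * delta s t)%g.
Proof.
move=> st /simple_mirror us /simple_mirror ut.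
move: us ut; rewrite !mirrorM !mirror_gen !simple_gen_mul => /andP[su us] /andP[_ ut].
rewrite -[(u * _)%g]mirrorK; apply: simple_mirror.
by rewrite mirrorM mirror_delta simpleM su legal_class legal_alt_m// us ut.
Qed.

Lemma simple_delta_elt s t : s != t -> simple (delta s t).
Proof.
by move=> st; rewrite -[delta _ _]mul1g simple_mul_delta// mul1g simple_gen.
Qed.

End Simple.

(** * Left cancellation and least common right multiples *)

Section Garside.
Variables (R : realType) (S : finType) (m : S -> S -> nat).
Hypothesis cm : coxeter_matrix m.

Local Notation P := (artin_monoid m).
Local Notation gen := (gen (artin_rel m)).
Local Notation simple := (@simple R S m).

(** A greatest element exists as soon as joins of two letters do. It is found by
    descending induction on [u], among the [v] with [u * v] in [D]. Those starting
    with a given letter [s] have a greatest element [s z_s]; if two letters [s] and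
    [t] occur, then [delta s t] divides [s z_s], which therefore also starts with
    [t] and divides [t z_t]. *)
Lemma closed_greatest (D : P -> Prop) (N : nat) :
  D 1%g -> (forall u v, D (u * v)%g -> D u) -> (forall u, D u -> (plen u <= N)%N) ->
  (forall u s t, s != t -> D (u * gen s)%g -> D (u * gen t)%g ->
    D (u * delta m s t)%g) ->
  exists2 z, D z & forall v, D v -> ldvd v z.
Proof.
move=> D1 Dl DN Dd.
suff : forall u, D u -> exists2 z, D (u * z)%g & forall v, D (u * v)%g -> ldvd v z.
  move=> /(_ _ D1)[z]; rewrite mul1g => Dz zmax; exists z => // v.
  by have := zmax v; rewrite mul1g.
move=> u; have [k] := ubnP (N - plen u)%N; elim: k u => // k ih u uk Du.
have [[s0 Ds0]|none] := pselect (exists s, D (u * gen s)%g); last first.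
  exists 1%g; first by rewrite mulg1.
  move=> v; have [->|[s [q ->]]] := P_case v; first by move=> _; exact: ldvd_refl.
  by rewrite mulgA => /Dl Ds; case: none; exists s.
have Z s : D (u * gen s)%g -> exists2 z, D (u * gen s * z)%g &
    forall v, D (u * gen s * v)%g -> ldvd v z.
  move=> Ds; apply: ih => //; have := DN _ Ds; have := DN _ Du.
  by rewrite plenM plen_gen; lia.
have [z0 Dz0 z0max] := Z _ Ds0.
exists (gen s0 * z0)%g; first by rewrite mulgA.
move=> v; have [->|[s [q ->]]] := P_case v.
  by move=> _; exists (gen s0 * z0)%g; rewrite mul1g.
move=> Dsq; have Ds : D (u * gen s)%g by move: Dsq; rewrite mulgA => /Dl.
have [ss|ss] := eqVneq s s0.
  by rewrite ss; apply: ldvd_mul2l; apply: z0max; rewrite -mulgA -ss.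
have [z Dz zmax] := Z _ Ds.
have ss0 : s0 != s by rewrite eq_sym.
apply: (@ldvd_trans _ _ (gen s * z)%g).
  by apply: ldvd_mul2l; apply: zmax; rewrite -mulgA.
have Dd0 := Dd u s s0 ss Ds Ds0.
have [e de] : ldvd (gen s) (delta m s s0) by exact: ldvd_gen_delta.
have [f zf] : ldvd e z by apply: zmax; rewrite -mulgA -de.
have [g dg] : ldvd (gen s0) (delta m s s0).
  by rewrite delta_sym//; exact: ldvd_gen_delta.
have eqz : (gen s * z = gen s0 * (g * f))%g by rewrite zf !mulgA -de dg.
rewrite eqz; apply: ldvd_mul2l; apply: z0max.
by rewrite -mulgA -eqz mulgA.
Qed.

(** If [w] is the greatest simple left divisor of an element, left multiplication
    by [u] makes it [u v], and [r] is what has to move on to the remainder. *)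
Definition head_tail (u w : P) (vr : P * P) : Prop :=
  [/\ w = (vr.1 * vr.2)%g, simple (u * vr.1)%g &
      forall v, ldvd v w -> simple (u * v)%g -> ldvd v vr.1].

Lemma head_tail_exists u w : simple u -> simple w -> exists vr, head_tail u w vr.
Proof.
move=> su sw; pose D v := ldvd v w /\ simple (u * v)%g.
have [|||u' s t st [us us'] [ut ut']|z [[r wr] uz] zmax] := @closed_greatest D (plen w).
- by split; [exists w; rewrite mul1g|rewrite mulg1].
- move=> a b [[c wc]]; rewrite mulgA => /(simple_mull cm) ua.
  by split=> //; exists (b * c)%g; rewrite mulgA.
- by move=> a [[c ->] _]; rewrite plenM leq_addr.
- split; last by rewrite mulgA simple_mul_delta// -mulgA.
  case: us ut => [a wa] [b wb].
  have e : (gen s * a = gen t * b)%g.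
    apply: (@simple_cancel R _ _ cm u'); rewrite ?mulgA -?wa -?wb//.
  have sa : simple (gen s * a)%g.
    by apply: (@simple_mulr R _ _ cm u'); rewrite mulgA -wa.
  have [||c dc] := simple_delta cm st sa; first exact: ldvd_mulr.
    by rewrite e; exact: ldvd_mulr.
  by exists c; rewrite wa -!mulgA dc.
- by exists (z, r); split=> // v vw uv; apply: zmax.
Qed.

Lemma head_tail_uniq u w vr vr' : simple w ->
  head_tail u w vr -> head_tail u w vr' -> vr = vr'.
Proof.
case: vr vr' => [v r] [v' r'] sw [/= wvr uv vmax] [/= wvr' uv' vmax'].
have vv' : v = v'.
  by apply: ldvd_anti; [apply: vmax' => //; exists r|apply: vmax => //; exists r'].
subst v'; congr (_, _); apply: (@simple_cancel R _ _ cm v); by rewrite -?wvr -?wvr'.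
Qed.

Definition split_head (u w : P) : P * P := xget (1%g, w) [set vr | head_tail u w vr].

Lemma split_headP u w : simple u -> simple w -> head_tail u w (split_head u w).
Proof.
move=> su sw; rewrite /split_head; case: xgetP => [//|none].
by have [vr /none] := head_tail_exists su sw.
Qed.

(** What left multiplication by [s] does to the pair formed by the greatest simple
    left divisor and the remainder. Pairs without a simple first component are
    fixed, so that the braid relations hold everywhere. *)
Definition pair_step (s : S) (wz : P * P) : P * P :=
  if simple wz.1 then
    ((gen s * (split_head (gen s) wz.1).1)%g, ((split_head (gen s) wz.1).2 * wz.2)%g)
  else wz.

Lemma split_head1 w : simple w -> split_head 1%g w = (w, 1%g).
Proof.
move=> sw; apply: (@head_tail_uniq 1%g w) => //.
  by apply: split_headP => //; exact: simple1.
by split=> /=; rewrite ?mulg1 ?mul1g.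
Qed.

(** Appending the letters of [u] one at a time extracts the same head of [w] as
    appending [u] at once; hence the steps satisfy the braid relations. *)
Lemma pair_step_foldr (l : seq S) w z :
  let u := pres_class (artin_rel m) l in
  simple u -> simple w ->
  foldr pair_step (w, z) l = ((u * (split_head u w).1)%g, ((split_head u w).2 * z)%g).
Proof.
elim: l => [|s l ih] /=.
  by move=> _ sw; rewrite pres_class_nil split_head1// !mul1g.
rewrite pres_class_cons; set u := pres_class _ l => su sw.
have su' : simple u := simple_mulr cm su.
rewrite ih//; set v := (split_head u w).1; set r := (split_head u w).2.
have [/= wvr uv vmax] := split_headP su' sw; rewrite -/v -/r in wvr uv vmax.
rewrite /pair_step /= uv.
have [/= e1 e2 emax] := split_headP (simple_gen R cm s) uv.
have [/= f1 f2 fmax] := split_headP su sw.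
set y := (split_head (gen s) _).1 in e1 e2 emax *.
set r' := (split_head (gen s) _).2 in e1 e2 emax *.
set v2 := (split_head (gen s * u)%g w).1 in f1 f2 fmax *.
set r2 := (split_head (gen s * u)%g w).2 in f1 f2 fmax *.
have uv2 : simple (u * v2)%g by move: f2; rewrite -mulgA; exact: simple_mulr.
have [d vd] : ldvd v2 v by apply: vmax => //; exists r2.
have [c yc] : ldvd (u * v2)%g y.
  apply: emax; last by rewrite mulgA.
  by rewrite vd mulgA; exact: ldvd_mulr.
have c1 : c = 1%g.
  have : ldvd (v2 * c)%g v2.
    apply: fmax; last by rewrite -!mulgA (mulgA u) -yc.
    exists (r' * r)%g; rewrite wvr mulgA; congr (_ * _)%g.
    by apply: (@simple_cancel R _ _ cm u); rewrite ?mulgA -?yc -?e1.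
  move=> [g /(congr1 (@plen S m))]; rewrite !plenM => h; apply: plen_eq0; lia.
rewrite yc c1 mulg1 mulgA; congr (_, _); rewrite mulgA; congr (_ * _)%g.
have dr' : d = r'.
  apply: (@simple_cancel R _ _ cm (u * v2)%g); rewrite -?mulgA -?vd//.
    by rewrite mulgA -[(u * v2)%g]mulg1 -c1 -yc -e1.
  by rewrite mulgA -[(u * v2)%g]mulg1 -c1 -yc -e1.
apply: (@simple_cancel R _ _ cm v2); rewrite ?mulgA -?dr' -?vd -?wvr -?f1//.
Qed.

Lemma artin_rel_pair_step l l' : artin_rel m l l' ->
  forall wz, foldr pair_step wz l = foldr pair_step wz l'.
Proof.
move=> [s t] [w z]; have [->//|st] := eqVneq s t; have ts : t != s by rewrite eq_sym.
have [sw|sw] := boolP (simple w); last first.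
  have fix_ k : foldr pair_step (w, z) k = (w, z).
    by elim: k => //= a k ->; rewrite /pair_step (negbTE sw).
  by rewrite !fix_.
have ets : pres_class (artin_rel m) (alt_word t s (m s t)) = delta m s t.
  by rewrite (delta_sym cm) /delta (coxeter_sym cm t s).
have sd : simple (delta m s t) by exact: simple_delta_elt.
by rewrite !pair_step_foldr ?ets.
Qed.

Definition normal (p : P) : P * P := pact pair_step p (1%g, 1%g).

Lemma normal_gen s p : normal (gen s * p)%g = pair_step s (normal p).
Proof. exact: (pact_genM artin_rel_pair_step). Qed.

Lemma normalP p : simple (normal p).1 /\ p = ((normal p).1 * (normal p).2)%g.
Proof.
elim/pres_ind: p => [|s p [sp pe]].
  by rewrite /normal (pact1 artin_rel_pair_step) /= mulg1; split=> //; exact: simple1.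
rewrite normal_gen /pair_step sp /=.
have [e1 e2 _] := split_headP (simple_gen R cm s) sp.
by split=> //; rewrite mulgA -(mulgA (gen s)) -e1 -mulgA -pe.
Qed.

(** The pair attached to [s x] determines the head [v] extracted from the greatest
    simple divisor of [x], and the remainder, hence [x] itself. *)
Lemma gen_mulI s : injective (fun p : P => gen s * p)%g.
Proof.
move=> x y /= /(congr1 normal); rewrite !normal_gen /pair_step.
have [sx xe] := normalP x; have [sy ye] := normalP y; rewrite sx sy.
have [ex1 ex2 _] := split_headP (simple_gen R cm s) sx.
have [ey1 ey2 _] := split_headP (simple_gen R cm s) sy.
case=> ev er.
have v : (split_head (gen s) (normal x).1).1 = (split_head (gen s) (normal y).1).1.
  exact: (simple_cancel cm ex2 ey2 ev).
by rewrite xe ye ex1 ey1 -!mulgA er v.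
Qed.

Lemma artin_mulI (p : P) : injective (fun q : P => p * q)%g.
Proof.
elim/pres_ind: p => [|s p ih] x y; first by rewrite /= !mul1g.
by rewrite /= -!mulgA => /gen_mulI /ih.
Qed.

(** The letters dividing [p] divide its greatest simple divisor, which reduces the
    claim to simple elements. *)
Lemma delta_ldvd p s t : s != t ->
  ldvd (gen s) p -> ldvd (gen t) p -> ldvd (delta m s t) p.
Proof.
have h r : ldvd (gen r) p -> ldvd (gen r) (normal p).1.
  move=> [q ->]; have [sq _] := normalP q.
  by rewrite normal_gen /pair_step sq /=; exact: ldvd_mulr.
have [sp pe] := normalP p => st /h ps /h pt.
by rewrite pe; apply: ldvd_trans (ldvd_mulr _ _); exact: (simple_delta cm st sp ps pt).
Qed.

(** The least common multiple is the greatest common left divisor of all common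
    multiples, since [p] and [q] are among these divisors. *)
Lemma artin_lcm (p q : P) : (exists x, ldvd p x /\ ldvd q x) ->
  exists z, pideal p `&` pideal q = pideal z.
Proof.
move=> [x0 [px0 qx0]]; pose D (v : P) := forall x, ldvd p x -> ldvd q x -> ldvd v x.
have [|||u s t st us ut|z Dz zmax] := @closed_greatest D (plen x0).
- by move=> x _ _; exists x; rewrite mul1g.
- by move=> u v Duv x px qx; apply: ldvd_trans (Duv x px qx); exact: ldvd_mulr.
- by move=> u /(_ _ px0 qx0)[r ->]; rewrite plenM leq_addr.
- move=> x px qx; have [a xa] := us x px qx; have [b xb] := ut x px qx.
  have e : (gen s * a = gen t * b)%g by apply: (@artin_mulI u); rewrite !mulgA -xa.
  have [|c dc] := @delta_ldvd (gen s * a)%g s t st (ldvd_mulr _ _).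
    by rewrite e; exact: ldvd_mulr.
  by exists c; rewrite xa -!mulgA dc.
exists z; apply/seteqP; split=> x.
  move=> [[a _ pa] [b _ qb]]; have [||r xr] := Dz x.
  - by exists a; rewrite pa.
  - by exists b; rewrite qb.
  by exists r; rewrite ?xr.
have [a za] : ldvd p z by apply: zmax.
have [b zb] : ldvd q z by apply: zmax.
move=> [c _ <-]; split.
  by exists (a * c)%g => //; rewrite mulgA -za.
by exists (b * c)%g => //; rewrite mulgA -zb.
Qed.

End Garside.

(** * A character stabilized by a dihedral parabolic subgroup *)

Section Parabolic.
Variables (R : realType) (S : finType) (m : S -> S -> nat).
Hypothesis cm : coxeter_matrix m.
Variables s t : S.

Local Notation P := (artin_monoid m).
Local Notation G := (artin_group m).
Local Notation iota := (@monoid_to_group S (artin_rel m)).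
Local Notation gen := (gen (artin_rel m)).
Local Notation cls := (pres_class (artin_rel m)).

Definition par (p : P) : bool := all (fun r => (r == s) || (r == t)) (repr p).

Lemma par_class w : par (cls w) = all (fun r => (r == s) || (r == t)) w.
Proof. by apply: eq_all_r; exact: (mem_repr_class R cm). Qed.

Lemma par1 : par 1%g.
Proof. by rewrite -pres_class_nil par_class. Qed.

Lemma parM p q : par (p * q)%g = par p && par q.
Proof.
by rewrite -(pres_reprK p) -(pres_reprK q) -pres_class_cat !par_class all_cat.
Qed.

Lemma par_gen r : par (gen r) = (r == s) || (r == t).
Proof. by rewrite par_class /= andbT. Qed.

Lemma par_iota p q : iota p = iota q -> par p = par q.
Proof. by move=> pq; apply: eq_all_r; exact: (iota_support R cm). Qed.

Lemma par_delta : par (delta m s t).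
Proof. by rewrite par_class; apply/allP => r /mem_alt_word. Qed.

(** Reading the alternating word with one more letter from either end shows
    that the fundamental element commutes with [s] and [t] up to exchanging
    them. *)
Lemma gen_delta r : (r == s) || (r == t) ->
  exists2 r', (r' == s) || (r' == t) & (gen r * delta m s t = delta m s t * gen r')%g.
Proof.
have h a b : exists2 r', (r' == a) || (r' == b) &
    (gen a * delta m b a = delta m a b * gen r')%g.
  exists (if odd (m a b) then b else a); first by case: odd; rewrite eqxx ?orbT.
  rewrite /delta -pres_class_cons (coxeter_sym cm b a) -alt_wordS alt_wordSr -cats1.
  exact: pres_class_cat.
move=> /orP[/eqP->|/eqP->]; first by rewrite {1}(delta_sym cm); exact: h.
by have [r' h1 h2] := h t s; exists r'; rewrite 1?orbC// [in RHS](delta_sym cm).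
Qed.

Lemma par_ldvd_delta_exp p : par p -> exists n, ldvd p (delta m s t ^+ n)%g.
Proof.
elim/pres_ind: p => [_|r p ih].
  by exists 0%N; exists 1%g; rewrite mulg1.
rewrite parM par_gen => /andP[rst /ih[n [q pq]]].
have [r' r'st er] : exists2 r', (r' == s) || (r' == t) &
    (gen r * delta m s t ^+ n = delta m s t ^+ n * gen r')%g.
  elim: (n) {pq} => [|k [r' r'st ek]]; first by exists r; rewrite ?mulg1 ?mul1g.
  have [r2 r2st e2] := gen_delta r'st; exists r2 => //.
  by rewrite expgSr mulgA ek -!mulgA e2.
exists n.+1; apply: (@ldvd_trans _ _ (gen r * delta m s t ^+ n)%g).
  by rewrite pq mulgA; exact: ldvd_mulr.
rewrite er expgSr; apply: ldvd_mul2l.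
by case/orP: r'st => /eqP->; [|rewrite delta_sym//]; exact: ldvd_gen_delta.
Qed.

(** Every element of the parabolic submonoid divides a power of the fundamental
    element, and these powers commute. *)
Lemma par_ore p q : par p -> par q ->
  exists x y, [/\ par x, par y & (p * x = q * y)%g].
Proof.
move=> pp pq; have [n [x px]] := par_ldvd_delta_exp pp.
have [k [y qy]] := par_ldvd_delta_exp pq.
have parX j : par (delta m s t ^+ j)%g.
  by elim: j => [|j ih]; [exact: par1|rewrite expgS parM par_delta].
have e : (p * (x * delta m s t ^+ k) = q * (y * delta m s t ^+ n))%g.
  by rewrite !mulgA -px -qy -!expgnDr addnC.
exists (x * delta m s t ^+ k)%g, (y * delta m s t ^+ n)%g; split=> //.
  by have := parX n; rewrite px !parM parX => /andP[_ ->].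
by have := parX k; rewrite qy !parM parX => /andP[_ ->].
Qed.

(** The filter of the principal ideals generated by the parabolic submonoid. *)
Definition par_char : {ptws constr_ideal (artin_rel m) -> bool} :=
  fun A => `[< exists2 p, par p & ideal_set A p >].

Lemma par_char_ideal p : par_char (ideal_of p) = par p.
Proof.
apply/asboolP/idP => [[q pq [x _ xq]]|pp].
  by move: pq; rewrite -xq parM => /andP[].
by exists p => //; exists 1%g => //; rewrite mulg1.
Qed.

Lemma ideal_mulr (A : constr_ideal (artin_rel m)) p q :
  ideal_set A p -> ideal_set A (p * q)%g.
Proof.
move=> Ap; have [A0|[a Aa]] := svalP A.
  by move: Ap; rewrite /ideal_set A0.
move: Ap; rewrite /ideal_set Aa => -[x _ <-].
by exists (x * q)%g => //; rewrite mulgA.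
Qed.

Lemma ideal_genE (p : P) : ideal_set (ideal_of p) = pideal p. Proof. by []. Qed.

Lemma pideal_mem (p : P) : pideal p p. Proof. by exists 1%g => //; rewrite mulg1. Qed.

Lemma par_char_Omega : Omega par_char.
Proof.
split.
- case; first by exists (ideal_of 1%g); rewrite par_char_ideal par1.
  by exists (ideal0 _); apply/asboolP => -[].
- by apply/asboolP => -[].
- move=> A B C CAB; apply/asboolP/andP.
    move=> [p pp]; rewrite CAB => -[Ap Bp].
    by split; apply/asboolP; exists p.
  move=> [/asboolP[a pa Aa] /asboolP[b pb Bb]].
  have [x [y [px py xy]]] := par_ore pa pb.
  exists (a * x)%g; first by rewrite parM pa.
  by rewrite CAB; split; [exact: ideal_mulr|rewrite xy; exact: ideal_mulr].
Qed.

(** If [p] and [q] had no common multiple, multiplicativity would give the value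
    one to the empty ideal. *)
Lemma Omega_lcm psi (p q : P) : Omega psi -> psi (ideal_of p) -> psi (ideal_of q) ->
  exists x y, (p * x = q * y)%g /\ psi (ideal_of (p * x)%g).
Proof.
move=> [_ psi0 psiM] pp pq.
have [[x [[a _ pa] [b _ qb]]]|none] := pselect (pideal p `&` pideal q !=set0).
  have [|z pqz] := artin_lcm R cm (p := p) (q := q).
    by exists x; split; [exists a|exists b].
  have : (pideal p `&` pideal q) z by rewrite pqz; exact: pideal_mem.
  move=> [[c _ pc] [d _ qd]]; exists c, d; rewrite pc qd; split=> //.
  by rewrite (psiM (ideal_of p) (ideal_of q)) ?pp// /= pqz.
have : psi (ideal0 _) = psi (ideal_of p) && psi (ideal_of q).
  by apply: psiM; apply/esym/eqP; move/set0P: none => /negP; rewrite negbK.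
by rewrite psi0 pp pq.
Qed.

(** The fiber over the character is closed under left multiplication by the
    parabolic submonoid. A value of [r g . psi] computed from some fraction
    [p1 / q1] is compared with a fraction [p2 / q2] of [g]: the denominators have a
    common multiple on which [psi] is one, so that [p1 z1 = r p2 z2] holds in the
    group, and the support of the right-hand side controls that of [p1]. *)
Lemma par_char_stable psi (g : G) (r : P) : Omega psi -> paction_dom g psi ->
  paction g psi = par_char -> par r ->
  paction_dom (iota r * g)%g psi /\ paction (iota r * g)%g psi = par_char.
Proof.
move=> Opsi [_ [p2 [q2 [gpq psiq2]]]] gpsi pr.
have reps p q : g = (iota p * (iota q)^-1)%g -> psi (ideal_of q) -> par p.
  move=> gE psiq; have <- : par_char (ideal_of p) = par p by exact: par_char_ideal.
  rewrite -gpsi; apply/asboolP; exists p, q, 1%g; split=> //; last by rewrite mulg1.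
  by rewrite mulg1 ideal_genE setIid.
split.
  split=> //; exists (r * p2)%g, q2; split=> //.
  by rewrite gpq monoid_to_groupM mulgA.
apply/funext => A; apply/asboolP/asboolP.
- move=> [p1 [q1 [y [g1 psiq1 Apy psiqy]]]]; exists (p1 * y)%g; last first.
    have : (ideal_set A `&` pideal p1) (p1 * y)%g by rewrite Apy; exact: pideal_mem.
    by case.
  have [z1 [z2 [zz psiz]]] := Omega_lcm Opsi psiqy psiq2.
  have : par (r * (p2 * z2))%g.
    rewrite parM pr; apply: (reps _ (q2 * z2)%g); last by rewrite -zz.
    by rewrite !monoid_to_groupM invgM mulgA mulgK.
  have -> : par (r * (p2 * z2))%g = par (p1 * y * z1)%g; last first.
    by rewrite parM => /andP[].
  apply: par_iota.
  have : (iota p1 * (iota q1)^-1 * iota (q1 * y * z1) =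
          iota r * g * iota (q2 * z2))%g by rewrite -g1 zz.
  by rewrite gpq !monoid_to_groupM !mulgA !mulgVK => ->.
- move=> [x px Ax]; have [x' [r' [px' pr' xr]]] := par_ore px pr.
  have : par_char (ideal_of r') by rewrite par_char_ideal.
  rewrite -gpsi => /asboolP[p [q [y [gE psiq ry psiqy]]]].
  have [r2 _ pyr] : pideal r' (p * y)%g.
    have : (pideal r' `&` pideal p) (p * y)%g by rewrite ry; exact: pideal_mem.
    by case.
  exists (r * (p * y))%g, (q * y)%g, 1%g; split.
  + by rewrite gE !monoid_to_groupM invgM !mulgA mulgK.
  + by [].
  + rewrite mulg1 setIidr// => _ [w _ <-]; apply: ideal_mulr.
    by rewrite -pyr mulgA -xr -mulgA; exact: ideal_mulr.
  + by rewrite mulg1.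
Qed.

(** The character is fixed by the identity, where the support of a positive element
    of the group again decides membership; the other elements follow by
    stability. *)
Lemma par_char_fixed r : par r ->
  paction_dom (iota r) par_char /\ paction (iota r) par_char = par_char.
Proof.
move=> pr; have O := par_char_Omega.
have iota1 : iota 1%g = 1%g by rewrite -pres_class_nil monoid_to_groupE.
have d1 : paction_dom (1%g : G) par_char.
  split=> //; exists 1%g, 1%g; split; first by rewrite iota1 mulgV.
  by rewrite par_char_ideal par1.
rewrite -[iota r]mulg1; apply: par_char_stable => //.
apply/funext => A; apply/asboolP/asboolP.
- move=> [p [q [y [gE]]]]; rewrite !par_char_ideal parM => pq Apy /andP[_ py].
  exists (p * y)%g; last first.
    have : (ideal_set A `&` pideal p) (p * y)%g by rewrite Apy; exact: pideal_mem.
    by case.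
  rewrite parM py andbT (@par_iota p q)//.
  by rewrite -[LHS](mulgVK (iota q)) -gE mul1g.
- move=> [x px Ax]; exists x, x, 1%g; rewrite !mulg1 par_char_ideal; split=> //.
    by rewrite mulgV.
  by rewrite setIidr// => _ [w _ <-]; exact: ideal_mulr.
Qed.

(** A length argument separates the character from those of the elements of the
    monoid, and the letter [u] separates it from the point at infinity. *)
Lemma par_char_Omega_tilde u : u != s -> u != t -> Omega_tilde par_char.
Proof.
move=> us ut; split; first exact: par_char_Omega.
move=> [[p _ e]|e].
- have : par_char (ideal_of p).
    by rewrite -e; apply/asboolP.
  rewrite par_char_ideal => pp.
  have : par_char (ideal_of (p * gen s)%g).
    by rewrite par_char_ideal parM pp par_gen eqxx.
  rewrite -e => /asboolP /(_ _ (pideal_mem p))[x _ /(congr1 (@plen S m))].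
  by rewrite !plenM plen_gen; lia.
- have : par_char (ideal_of (gen u)).
    by rewrite e; apply/asboolP; exists (gen u); exact: pideal_mem.
  by rewrite par_char_ideal par_gen (negbTE us) (negbTE ut).
Qed.

End Parabolic.

(** * Ping-pong for almost invariant masses *)

Section ApproximateInvariance.
Local Open Scope ereal_scope.
Variables (R : realType) (A : choiceType) (Z : set A) (f : A -> R).
Hypothesis f0 : forall x, Z x -> (0 <= f x)%R.

Definition mass (D : set A) : \bar R := \esum_(x in Z `&` D) (f x)%:E.

Lemma mass_ge0 D : 0 <= mass D.
Proof. by apply: esum_ge0 => x [Zx _]; rewrite lee_fin f0. Qed.

Lemma esum_subset (B C : set A) (a : A -> \bar R) : B `<=` C ->
  (forall x, C x -> 0 <= a x) -> \esum_(x in B) a x <= \esum_(x in C) a x.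
Proof.
move=> BC a0; rewrite [leRHS](esumID B)// setIidr// leeDl//.
by apply: esum_ge0 => x [Cx _]; exact: a0.
Qed.

Lemma mass_setU D E : D `&` E = set0 -> mass (D `|` E) = mass D + mass E.
Proof.
move=> DE; rewrite /mass (esumID D); last by move=> x [Zx _]; rewrite lee_fin f0.
have -> : Z `&` (D `|` E) `&` D = Z `&` D.
  apply/seteqP; split=> x; first by move=> [[Zx _] Dx].
  by move=> [Zx Dx]; split=> //; split=> //; left.
have -> // : Z `&` (D `|` E) `&` ~` D = Z `&` E.
apply/seteqP; split=> x; first by move=> [[Zx []//]].
move=> [Zx Ex]; split; first by split=> //; right.
by move=> Dx; have : (D `&` E) x by []; rewrite DE.
Qed.

(** The mass outside [D'] is transported by [L] into [D] up to an error [e], so [D]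
    and [D'] together carry almost all of the mass. *)
Lemma mass_pingpong (L L' : A -> A) (D D' : set A) (e : \bar R) :
  \esum_(x in Z) (f x)%:E = 1 ->
  (forall x, Z x -> Z (L x)) -> cancel L L' ->
  (forall x, Z x -> ~ D' x -> D (L x)) ->
  \esum_(x in Z) (`| f (L' x) - f x |%R)%:E < e ->
  1 < mass D + mass D' + e.
Proof.
move=> f1 ZL LK DL fe.
pose d x : \bar R := (`| f (L' x) - f x |%R)%:E.
have d0 x : 0 <= d x by rewrite lee_fin.
pose B := Z `&` ~` D'.
have LB : L @` B `<=` Z `&` D.
  by move=> _ [x [Zx D'x] <-]; split; [exact: ZL|exact: DL].
have massB : \esum_(x in B) (f x)%:E <= mass D + \esum_(x in Z) d x.
  apply: (@le_trans _ _ (\esum_(x in B) ((f (L x))%:E + d (L x)))).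
    apply: le_esum => x _; rewrite /d LK -EFinD lee_fin.
    by rewrite -lerBlDl (le_trans (ler_norm _)).
  rewrite -(@reindex_esum _ _ _ B (L @` B) L (fun x => (f x)%:E + d x)); last first.
    split; [by move=> x Bx; exists x| |by []].
    by move=> x y _ _; exact: (can_inj LK).
  apply: (@le_trans _ _ (\esum_(x in Z `&` D) ((f x)%:E + d x))).
    by apply: esum_subset => // x [Zx _]; rewrite adde_ge0// lee_fin f0.
  rewrite esumD//; last by move=> x [Zx _]; rewrite lee_fin f0.
  by rewrite leeD2l// esum_subset//; exact: subIsetl.
have massD_fin : mass D \is a fin_num.
  rewrite ge0_fin_numE ?mass_ge0// (@le_lt_trans _ _ 1) ?ltry// -f1.
  by apply: esum_subset; [exact: subIsetl|move=> x Zx; rewrite lee_fin f0].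
have massD'_fin : mass D' \is a fin_num.
  rewrite ge0_fin_numE ?mass_ge0// (@le_lt_trans _ _ 1) ?ltry// -f1.
  by apply: esum_subset; [exact: subIsetl|move=> x Zx; rewrite lee_fin f0].
rewrite -f1 (esumID D'); last by move=> x Zx; rewrite lee_fin f0.
rewrite -/(mass D') -/B (@le_lt_trans _ _ (mass D' + (mass D + \esum_(x in Z) d x)))//.
  by rewrite leeD2l.
by rewrite addeA [mass D' + _]addeC lteD2lE// fin_numD massD_fin.
Qed.

End ApproximateInvariance.

Section PingPong.
Variables (R : realType) (S : finType) (m : S -> S -> nat).
Hypothesis cm : coxeter_matrix m.
Variables s t : S.
Hypothesis m2 : (2 < m s t)%N.

Local Notation G := (artin_group m).
Local Notation iota := (@monoid_to_group S (artin_rel m)).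
Local Notation gen := (gen (artin_rel m)).

(* At parameter 1/2 a generator multiplies its own coordinate by -1/4, and its
   cube contracts enough for ping-pong on four disjoint regions. *)
Let half : R := 1 / 2.

Let half_neq0 : half != 0.
Proof. by rewrite /half div1r invr_eq0 pnatr_eq0. Qed.

Definition cube (a : S) : G := iota (gen a * gen a * gen a)%g.

(** The constant 13/32 is half the sum 1 - 1/4 + 1/16, the three steps meeting
    the initial coordinate at [a] multiplied by 1, -1/4 and 1/16. *)
Lemma gact_cube a b g (x : S -> R) : a != b ->
  gact half (cube a * g)%g x a = - (gact half g x a) / 64 /\
  gact half (cube a * g)%g x b =
    gact half g x b + 13 / 32 * (ckappa R m a b * gact half g x a).
Proof.
move=> ab; have ba : b != a by rewrite eq_sym.
have T3 : gact half (cube a * g)%g x =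
    iter 3 (burau (ckappa R m) half a) (gact half g x).
  rewrite (gactM cm)// (gact_iota cm)// /mact.
  have rel := artin_rel_burau cm half_neq0.
  by rewrite !(pactM rel) !(pact_gen rel).
rewrite T3 /=; move: (gact half g x) => y.
by split; rewrite ?(burau_off _ _ _ ba) !burau_diag /half; field.
Qed.

(** A vector that [g] moves out of the common kernel of the coordinates at [s] and
    [t]. It is chosen from a set that does not change when [g] is multiplied on the
    left by a word in [s] and [t], which makes the map [plane_point] from the
    group to the punctured plane equivariant. *)
Definition witness (g : G) : S -> R :=
  xget (fun=> 0) [set x | (gact half g x s != 0) || (gact half g x t != 0)].

Definition plane_point (g : G) : S -> R := gact half g (witness g).

Let st : s != t.
Proof. by apply/eqP => st; move: m2; rewrite st coxeter_diag. Qed.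

Lemma plane_point_neq0 g : (plane_point g s != 0) || (plane_point g t != 0).
Proof.
rewrite /plane_point /witness; case: xgetP => [x -> //|none].
have /negP[] := none (gact half g^-1%g (fun=> 1)).
by rewrite -(gactM cm)// mulgV (gact1 cm)// oner_neq0.
Qed.

Lemma witness_cube a g : (a == s) || (a == t) ->
  witness (cube a * g)%g = witness g.
Proof.
have h c d x : c != d ->
    (gact half (cube c * g)%g x c != 0) || (gact half (cube c * g)%g x d != 0) =
    (gact half g x c != 0) || (gact half g x d != 0).
  move=> cd; have [-> ->] := gact_cube g x cd.
  rewrite mulf_eq0 oppr_eq0 invr_eq0 pnatr_eq0 orbF.
  by have [->|] := eqVneq (gact half g x c) 0; rewrite ?mulr0 ?addr0.
move=> ast; congr (xget _ _); apply/funext => x; apply/propext.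
have ts : t != s by rewrite eq_sym.
by case/orP: ast => /eqP-> /=; [rewrite h|rewrite orbC h// orbC].
Qed.

(** Neighbourhoods of the two lines fixed by the cube of [a]: the axis where the
    coordinate at [a] vanishes, which attracts, and a line whose slope lies
    strictly between 1/5 and 1 in absolute value, which repels. *)
Definition attracts (a b : S) (g : G) : bool :=
  5 * `|plane_point g a| < `|plane_point g b|.

Definition repels (a b : S) (g : G) : bool :=
  `|plane_point g b| < `|plane_point g a| <= 5 * `|plane_point g b|.

(** As [kappa] lies between 1 and 2, the term added to the coordinate [y] at [b] is
    between 13/32 and 13/16 of the size of the coordinate [x] at [a]. It cannot
    nearly cancel [y] when [y] is at least as large as [x] or less than a fifth of
    it, whereas the new coordinate at [a] is only [x / 64] in size. *)
Lemma cube_attracts a b g :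
  (a = s /\ b = t) \/ (a = t /\ b = s) ->
  ~~ repels a b g -> attracts a b (cube a * g)%g.
Proof.
move=> abst.
have ab : a != b by case: abst => -[-> ->] //; rewrite eq_sym.
have mab : (2 < m a b)%N by case: abst => -[-> ->] //; rewrite coxeter_sym.
have ast : (a == s) || (a == t) by case: abst => -[-> _]; rewrite eqxx ?orbT.
rewrite /repels /attracts /plane_point witness_cube// -/(plane_point g).
have [-> ->] := gact_cube g (witness g) ab; rewrite -/(plane_point g).
have nz : 0 < `|plane_point g a| + `|plane_point g b|.
  have := plane_point_neq0 g; rewrite -normr_gt0 -(normr_gt0 (_ t)).
  have := normr_ge0 (plane_point g s); have := normr_ge0 (plane_point g t).
  by case: abst => -[-> ->] ? ? /orP[?|?]; lra.
move: nz; set x := plane_point g a; set y := plane_point g b => nz.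
have k1 : 1 <= ckappa R m a b by rewrite /ckappa kappa_ge1// ltnW.
have k2 : ckappa R m a b < 2.
  by have := kappa_sqr_lt4 R (ltnW mab); rewrite -/(ckappa R m a b); nra.
have kx : `|ckappa R m a b * x| = ckappa R m a b * `|x|.
  by rewrite normrM ger0_norm// (le_trans _ k1).
have x0 := normr_ge0 x; have y0 := normr_ge0 y.
have kx1 : `|x| <= `|ckappa R m a b * x| by rewrite kx; nra.
have kx2 : `|ckappa R m a b * x| <= 2 * `|x| by rewrite kx; nra.
set z := ckappa R m a b * x in kx kx1 kx2 *.
have z13 : `|13 / 32 * z| = 13 / 32 * `|z| by rewrite normrM ger0_norm//; lra.
have n1 := lerB_normD y (13 / 32 * z).
have n2 := lerB_normD (13 / 32 * z) y.
rewrite [_ * z + y]addrC in n2.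
rewrite z13 in n1 n2.
have -> : `|- x / 64| = `|x| / 64 by rewrite normrM normrN ger0_norm//; lra.
rewrite negb_and -leNgt -ltNge => /orP[h|h]; lra.
Qed.

End PingPong.

(** * Non-amenability *)

Theorem proposition4p15 (R : realType) (S : finType) (m : S -> S -> nat)
    (coxeter_m : coxeter_matrix m) (finite_type_m : finite_type m)
    (three_generators : (2 < #|S|)%N)
    (nontrivial_braid : exists s t : S, (2 < m s t)%N) :
  ~ amenable R (artin_groupoid m).
Proof.
have cm := coxeter_m; move: nontrivial_braid => [s [t m2]].
have st : s != t by apply/eqP => st; move: m2; rewrite st coxeter_diag.
have [u [us ut]] : exists u, u != s /\ u != t.
  have [u] : exists u, u \in ~: [set s; t]%SET.
    by apply/card_gt0P; rewrite cardsCs finset.setCK cards2 st subn_gt0.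
  by rewrite !inE negb_or => /andP[us ut]; exists u.
pose chi := @par_char S m s t.
move=> [I [F [M [FF Msys Minv]]]].
have par_cube a : (a == s) || (a == t) ->
    par s t (gen (artin_rel m) a * gen (artin_rel m) a * gen (artin_rel m) a)%g.
  by move=> ast; rewrite !(parM R cm) !(par_gen R cm) ast.
have fixed a : (a == s) || (a == t) ->
    paction_dom (cube m a) chi /\ paction (cube m a) chi = chi.
  by move=> ast; apply: (par_char_fixed R cm); exact: par_cube.
have chiO : Omega_tilde chi by exact: (par_char_Omega_tilde R cm us ut).
pose Gd := artin_groupoid m.
pose gam a : gpd_ambient Gd := (cube m a, chi).
have near_gam a : (a == s) || (a == t) ->
    \forall i \near F, (translation_defect (Gd := Gd) (M i) (gam a) < (1 / 2 : R)%:E)%E.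
  move=> ast; have [da _] := fixed a ast.
  have sub : [set gam a] `<=` gpd_arrow Gd by move=> _ ->.
  have half_gt0 : 0 < 1 / 2 :> R by rewrite divr_gt0.
  have := Minv [set gam a] (@compact_set1 _ (gam a)) sub _ half_gt0.
  by apply: filterS => i; apply.
have [i [ds dt]] : exists i,
    (translation_defect (Gd := Gd) (M i) (gam s) < (1 / 2 : R)%:E)%E /\
    (translation_defect (Gd := Gd) (M i) (gam t) < (1 / 2 : R)%:E)%E.
  by apply: (@filter_ex _ F); apply: filterI; apply: near_gam; rewrite eqxx ?orbT.
have [M0 M1] := (Msys i).1 chi chiO.
pose Z := gpd_fiber (Gd := Gd) chi.
pose zone a b := [set eta : gpd_ambient Gd | attracts R s t a b eta.1]
                 `|` [set eta : gpd_ambient Gd | repels R s t a b eta.1].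
have disj a b : [set eta : gpd_ambient Gd | attracts R s t a b eta.1] `&`
    [set eta : gpd_ambient Gd | repels R s t a b eta.1] = set0.
  apply/seteqP; split=> // eta [] /=; rewrite /attracts /repels => ? /andP[].
  by have := normr_ge0 (plane_point R s t eta.1 a); lra.
have ping a b : (a = s /\ b = t) \/ (a = t /\ b = s) ->
    (translation_defect (Gd := Gd) (M i) (gam a) < (1 / 2 : R)%:E)%E ->
    (1 < mass Z (M i chi) (zone a b) + (1 / 2 : R)%:E)%E.
  move=> abst da.
  have ast : (a == s) || (a == t) by case: abst => -[-> _]; rewrite eqxx ?orbT.
  have [doma acta] := fixed a ast.
  rewrite (mass_setU M0 (disj a b)).
  apply: (@mass_pingpong _ _ _ _ M0 (fun eta => ((cube m a * eta.1)%g, eta.2))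
    (fun eta => (((cube m a)^-1 * eta.1)%g, eta.2))).
  - exact: M1.
  - move=> [g psi] [[domg psiO] gpsi].
    have [domg' gpsi'] := par_char_stable R cm psiO.1 domg gpsi (par_cube a ast).
    by split.
  - by move=> [g psi]; rewrite /= mulKg.
  - by move=> [g psi] _ /negP gr; exact: (cube_attracts cm m2 abst gr).
  - by move: da; rewrite /translation_defect [gpd_rng _]acta.
have pst := ping s t (or_introl (conj erefl erefl)) ds.
have pts := ping t s (or_intror (conj erefl erefl)) dt.
have disj4 : zone s t `&` zone t s = set0.
  apply/seteqP; split=> // eta [h1 h2]; exfalso; move: h1 h2.
  have := normr_ge0 (plane_point R s t eta.1 s).
  have := normr_ge0 (plane_point R s t eta.1 t).
  clear; move=> ? ? [] /=; rewrite /attracts /repels => ? [] /=;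
    rewrite /attracts /repels => ?; lra.
have : (mass Z (M i chi) (zone s t `|` zone t s) <= 1)%E.
  rewrite -M1; apply: esum_subset; first exact: subIsetl.
  by move=> eta /M0; rewrite lee_fin.
rewrite (mass_setU M0 disj4).
have := mass_ge0 M0 (zone s t); have := mass_ge0 M0 (zone t s).
move: pst pts; set x := mass _ _ _; set y := mass _ _ _.
case: x y => [x||] [y||] //=; rewrite -?EFinD ?lte_fin ?lee_fin.
lra.
Qed.
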